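(* Let $M$ be an oriented matroid of rank $r$ on a finite set $E$, and let $L$ be the lattice of flats of its underlying matroid. Let $\mathcal F=\{\hat 0=F_0<F_1<\cdots<F_r=\hat 1\}$ be a complete flag in $L$ and choose $e_1,\dots,e_r\in E$ with $e_i\in F_i\setminus F_{i-1}$ for each $i$. Let $S_G=S_G(\mathcal F)$ ($G\in L$) be the simplicial complexes defined in the context, regarded as posets of nonempty simplices ordered by inclusion. For a cocircuit $X\in C^*(M)$ let $i_X=\min\{i:X(e_i)\ne 0\}$ and let $\iota(X)$ be the single vertex $\{(X^{-1}(0))_{\epsilon}\}$ with $\epsilon=X(e_{i_X})\in\{+,-\}$; for an arbitrary $Y\in V^*(M)\setminus\{0\}$ let $$\iota(Y)=\bigcup_{X\in C^*(M),\,X\le Y}\iota(X).$$ Then $\iota$ is a well-defined injective order-preserving map $\iota:V^*(M)\setminus\{0\}\to S_{\hat 0}$ which takes $M_G\setminus\{0\}$ into $S_G$ for every $G\in L$. Further, $\iota$ induces a homotopy equivalence $\Delta(V^*(M)\setminus\{0\})\to\Delta S_{\hat 0}$ and restricts to a homotopy equivalence $\Delta(M_G\setminus\{0\})\to\Delta S_G$ for every $G\in L$, and the $\mathbb Z_2$ action on $S_{\hat 0}$ (exchanging $H_+$ and $H_-$ for every coatom $H$ of $L$) restricts to the usual $\mathbb Z_2$ action $\iota(X)\mapsto\iota(-X)$ on $\iota(V^*(M)\setminus\{0\})$.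
   Context: Oriented matroids are given by covectors: $V^*(M)\subseteq\{+,0,-\}^E$ is the set of covectors of $M$ (satisfying the standard covector axioms). The set $\{+,-,0\}$ is ordered with $0$ below the two incomparable maximal elements $+$ and $-$, and $\{+,0,-\}^E$ is ordered componentwise. The set $C^*(M)$ of cocircuits is the set of minimal nonzero elements of $V^*(M)$. The underlying matroid of $M$ has lattice of flats $L=\{X^{-1}(0):X\in V^*(M)\}$, ordered by inclusion; it is a geometric lattice of rank $r$, and its coatoms are the sets $X^{-1}(0)$, $X\in C^*(M)$, each coatom arising from exactly two cocircuits $X,-X$. For $G\in L$, $M_G=\{X\in V^*(M): X(e)=0 \text{ for all } e\in G\}$. A complete flag in $L$ is a maximal chain. $\Delta P$ denotes the order complex of a poset $P$. Construction of $S_G(\mathcal F)$. For $X\in L$, $\operatorname{coat}(X)$ denotes the set of coatoms of $L$ that are $\ge X$. Put $A_i=\operatorname{coat}(F_i)\setminus \operatorname{coat}(F_{i+1})$ for $i=0,\dots,r-1$; these sets partition the set of coatoms of $L$. Take two vertices $H_+,H_-$ for each coatom $H$. For $G\in L$, $S_G$ is the simplicial complex whose maximal simplices are the sets $W_0\cup\cdots\cup W_{r-1}$, where for each $i$ independently, $W_i$ is either $\{H_+:H\in\operatorname{coat}(G)\cap A_i\}$ or $\{H_-:H\in\operatorname{coat}(G)\cap A_i\}$. In particular $S_{\hat 1}=\emptyset$, and every $S_G$ is a subcomplex of $S_{\hat 0}$. *)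

(* Defs.v *)
From mathcomp Require Import all_boot all_order all_algebra.

Set Implicit Arguments.
Unset Strict Implicit.
Unset Printing Implicit Defensive.

(* A sign is an [option bool]: [None] is 0, [Some true] is + and [Some false]
   is -.  Accordingly a nonzero sign is a [bool]. *)
Definition signvec (E : finType) := {ffun E -> option bool}.

Section SignVectors.
Variable E : finType.
Implicit Types X Y : signvec E.

Definition sv0 : signvec E := [ffun => None].

Definition svopp X : signvec E := [ffun e => omap negb (X e)].

Definition svcomp X Y : signvec E :=
  [ffun e => if X e is Some a then Some a else Y e].

Definition svsep X Y : {set E} :=
  [set e | (X e != None) && (X e == svopp Y e)].

(* 0 lies below the two incomparable elements + and -. *)
Definition sign_le (a b : option bool) := (a == None) || (a == b).

Definition svle : rel (signvec E) := fun X Y => [forall e, sign_le (X e) (Y e)].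

Definition zeros X : {set E} := [set e | X e == None].

End SignVectors.

Arguments sv0 {E}.

(* Covector axioms (L0)-(L3) of Bjorner, Las Vergnas, Sturmfels, White and
   Ziegler, Oriented Matroids, 4.1.1.  In the last one X o Y and Y o X agree
   outside the separation set. *)
Record orientedMatroid (E : finType) := OrientedMatroid {
  covectors : {set signvec E};
  covectors0 : sv0 \in covectors;
  covectorsN : {in covectors, forall X, svopp X \in covectors};
  covectors_comp : {in covectors &, forall X Y, svcomp X Y \in covectors};
  covectors_elim : {in covectors &, forall X Y e, e \in svsep X Y ->
    exists Z, [/\ Z \in covectors, Z e = None &
                  forall f, f \notin svsep X Y -> Z f = svcomp X Y f]}
}.

(* The simplices of the order complex of the subposet P of (T, le). *)
Definition order_complex (T : finType) (le : rel T) (P : {set T}) :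
    {set {set T}} :=
  [set C : {set T} | [&& C != set0, C \subset P &
    [forall x in C, [forall y in C, le x y || le y x]]]].

Definition subset_rel (T : finType) : rel {set T} := fun A B => A \subset B.

Section OrientedMatroidTheory.
Variables (E : finType) (M : orientedMatroid E).

Definition nonzero_covectors : {set signvec E} := covectors M :\ sv0.

Definition cocircuits : {set signvec E} :=
  [set X in nonzero_covectors |
    [forall Y in nonzero_covectors, svle Y X ==> (Y == X)]].

(* M_G *)
Definition covectors_vanishing (G : {set E}) : {set signvec E} :=
  [set X in covectors M | [forall e in G, X e == None]].

Definition flats : {set {set E}} := [set zeros X | X in covectors M].

Definition flat_bot : {set E} := \bigcap_(G in flats) G.

Definition flat_top : {set E} := \bigcup_(G in flats) G.

(* The maximal length of a chain of flats. *)
Definition om_rank : nat :=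
  \max_(C in order_complex (@subset_rel E) flats) #|C|.-1.

Definition coatoms : {set {set E}} :=
  [set H | maxset [pred G | (G \in flats) && (G != flat_top)] H].

Definition coat (G : {set E}) : {set {set E}} :=
  [set H in coatoms | G \subset H].

Section Flag.
Variables (r : nat) (F : 'I_r.+1 -> {set E}).

(* A maximal chain of flats, listed increasingly. *)
Definition complete_flag : Prop :=
  [/\ forall i, F i \in flats,
      F ord0 = flat_bot /\ F ord_max = flat_top,
      forall i j : 'I_r.+1, i < j -> F i \proper F j &
      forall G, G \in flats ->
        (forall i, (G \subset F i) || (F i \subset G)) -> exists i, G = F i].

(* F_i and F_(i+1), for i < r *)
Definition flag_pred (i : 'I_r) : {set E} := F (widen_ord (leqnSn r) i).
Definition flag_succ (i : 'I_r) : {set E} := F (lift ord0 i).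

Definition coat_block (i : 'I_r) : {set {set E}} :=
  coat (flag_pred i) :\: coat (flag_succ i).

(* The vertex H_+ is (H, true) and the vertex H_- is (H, false). *)
Definition S_facet (G : {set E}) (w : {ffun 'I_r -> bool}) :
    {set {set E} * bool} :=
  \bigcup_(i < r) [set (H, w i) | H in coat G :&: coat_block i].

(* The nonempty simplices of S_G. *)
Definition S_complex (G : {set E}) : {set {set {set E} * bool}} :=
  [set s | (s != set0) && [exists w, s \subset S_facet G w]].

End Flag.

Section Iota.
(* The index i : 'I_r stands for the index i + 1 in e_1, ..., e_r. *)
Variables (r : nat) (e : 'I_r -> E).

Definition first_nonzero (X : signvec E) : option 'I_r :=
  [pick i : 'I_r | (X (e i) != None) &&
                   [forall j : 'I_r, (j < i) ==> (X (e j) == None)]].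

Definition iota_cocircuit (X : signvec E) : {set {set E} * bool} :=
  if first_nonzero X is Some i then
    if X (e i) is Some eps then [set (zeros X, eps)] else set0
  else set0.

Definition covector_iota (Y : signvec E) : {set {set E} * bool} :=
  \bigcup_(X in cocircuits | svle X Y) iota_cocircuit X.

End Iota.

End OrientedMatroidTheory.

(* The exchange of H_+ and H_- on sets of vertices. *)
Definition swap_signs (E : finType) (s : {set {set E} * bool}) :
    {set {set E} * bool} :=
  [set (v.1, ~~ v.2) | v in s].

From mathcomp Require Import all_classical all_reals topology normedtype.
Import Order.TTheory GRing.Theory Num.Theory.
Import numFieldNormedType.Exports.

Local Open Scope classical_set_scope.
Local Open Scope ring_scope.

Section Homotopy.
Variable R : realType.

Definition continuous_map (X Y : topologicalType) (A : set X) (B : set Y)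
    (f : X -> Y) : Prop :=
  (forall x, A x -> B (f x)) /\ {within A, continuous f}.

Definition homotopic (X Y : topologicalType) (A : set X) (B : set Y)
    (f g : X -> Y) : Prop :=
  exists H : R * X -> Y,
    [/\ continuous_map ((`[0, 1] : set R) `*` A) B H,
        forall x, A x -> H (0, x) = f x &
        forall x, A x -> H (1, x) = g x].

Definition homotopy_equivalence (X Y : topologicalType) (A : set X) (B : set Y)
    (f : X -> Y) : Prop :=
  continuous_map A B f /\
  exists g : Y -> X,
    [/\ continuous_map B A g,
        homotopic A A (g \o f) id &
        homotopic B B (f \o g) id].

(* The geometric realization of a complex K with vertices in T, as a subspace
   of R^T (barycentric coordinates). *)
Definition realization (T : finType) (K : {set {set T}}) :
    set {ptws T -> R} :=
  [set x | [/\ forall t, 0 <= x t, \sum_t x t = 1 &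
               [set t | x t != 0]%SET \in K]].

(* The linear extension of a map on vertices. *)
Definition realization_map (T U : finType) (f : T -> U) :
    {ptws T -> R} -> {ptws U -> R} :=
  fun x u => \sum_(t | f t == u) x t.

(* f induces a homotopy equivalence from the order complex of the subposet P of
   (T, leT) to that of the subposet Q of (U, leU). *)
Definition induces_homotopy_equivalence (T U : finType)
    (leT : rel T) (leU : rel U) (P : {set T}) (Q : {set U})
    (f : T -> U) : Prop :=
  homotopy_equivalence (realization (order_complex leT P))
    (realization (order_complex leU Q)) (realization_map f).

End Homotopy.

(* Main.v *)
(* Call (i, eps) the type of a covector X if e_i is the first of e_1, ..., e_r at
   which X does not vanish and X(e_i) = eps. The simplex iota Y meets the block A_i
   with sign eps iff some covector X <= Y has type (i, eps). So the covectors Y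
   whose image meets the blocks i_1 < ... < i_k with signs w_1, ..., w_k are those
   above a chain X_1 >= ... >= X_k of covectors of types (i_j, w_j). This upper set
   has a contractible order complex: X_1 can be forgotten, since the covectors of
   type (i_1, w_1) above a given X_2 form a set of sign vectors closed under
   composition and elimination, and any nonempty set of that kind has a
   contractible order complex, by deleting one element of the ground set at a time.
   A fiber lemma in the style of Quillen then turns iota into a homotopy
   equivalence. Inverse maps and homotopies on geometric realizations are obtained
   by adding one vertex at a time and extending over the cone so created. *)

Require Import Defs.
From mathcomp Require Import all_boot all_order all_algebra.
From mathcomp Require Import all_classical all_reals topology normedtype.
From mathcomp Require Import lra.

Set Implicit Arguments.
Unset Strict Implicit.
Unset Printing Implicit Defensive.

(** * Continuity and homotopies *)

Section WithinContinuous.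
Import Order.TTheory GRing.Theory Num.Theory.
Import numFieldNormedType.Exports.
Local Open Scope classical_set_scope.
Local Open Scope ring_scope.

(** The classical fibers of [iota] cannot be used: a simplex [s] may collect vertices of one block
    that no covector has below it together, so the set of [Y] with [s] contained in [iota Y] may be
    empty. The remedy is to forget the coatoms and keep only blocks and signs, which is why the
    fiber lemma carries two families, [S] in the source and [D] in the target, instead of principal
    upper sets and their preimages. Blocks and signs can be read off covectors because e_1, ..., e_k
    span F_k: the zero set of a covector whose first nonzero value is at e_i contains F_(i-1) but
    not F_i. The upper sets that occur are not covector sets of oriented matroids, since prescribing
    signs destroys zero and negation; composition and elimination survive, and contractibility is
    derived from these two. *)

Lemma within_continuous_eq (X Y : topologicalType) (A : set X) (f g : X -> Y) :
  (forall x, A x -> f x = g x) ->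
  {within A, continuous f} -> {within A, continuous g}.
Proof.
by move=> fg; apply: subspace_eq_continuous => x; rewrite inE => /fg.
Qed.

Lemma within_continuous_to (X Y Z : topologicalType) (A : set X) (B : set Y)
    (f : X -> Y) (g : Y -> Z) :
  {within A, continuous f} -> (forall x, A x -> B (f x)) ->
  {within B, continuous g} -> {within A, continuous (g \o f)}.
Proof.
rewrite !subspace_continuousP => cf fAB cg x Ax; apply: cvg_comp (cg _ (fAB _ Ax)).
move=> P; rewrite /within /= => nP; have := cf x Ax _ nP.
rewrite /= /within /= !nbhs_simpl /=; apply: filterS => z zP Az.
by apply: zP => //; exact: fAB.
Qed.

Lemma within_continuous_pair (X Y Z : topologicalType) (A : set X)
    (f : X -> Y) (g : X -> Z) :
  {within A, continuous f} -> {within A, continuous g} ->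
  {within A, continuous (fun x => (f x, g x))}.
Proof. by move=> cf cg x; apply: cvg_pair; [exact: cf|exact: cg]. Qed.

(** The pasting lemma for two closed sets covering [A]: a point outside one of them has a
    neighbourhood avoiding it, so each piece gives a condition near every point of [A]. *)
Lemma within_continuous_glue (X Y : topologicalType) (A C1 C2 : set X)
    (f : X -> Y) : closed C1 -> closed C2 -> (forall x, A x -> C1 x \/ C2 x) ->
  {within A `&` C1, continuous f} -> {within A `&` C2, continuous f} ->
  {within A, continuous f}.
Proof.
move=> cl1 cl2 A12; rewrite !subspace_continuousP => c1 c2 x Ax P nP.
have side C : closed C -> (forall x0, (A `&` C) x0 ->
    f x @[x --> within (A `&` C) (nbhs x0)] --> f x0) ->
    \forall y \near x, A y -> C y -> P (f y).
  move=> clC cC; have [Cx|nCx] := pselect (C x).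
    have /(_ P nP) : f @ within (A `&` C) (nbhs x) --> f x by exact: cC.
    rewrite nbhs_filterE /= => nAC.
    by apply: (@filterS _ (nbhs x) _ _ _ _ nAC) => y yP Ay Cy; apply: yP.
  have : nbhs x (~` C) by apply: open_nbhs_nbhs; split => //; exact: closed_openC.
  by apply: filterS => y nCy _ Cy.
have n1 := side _ cl1 c1; have n2 := side _ cl2 c2.
suff : \forall y \near x, A y -> P (f y) by [].
near=> y => Ay.
have [Cy|Cy] := A12 _ Ay.
  by move: Ay Cy; near: y.
by move: Ay Cy; near: y.
Unshelve. all: by end_near. Qed.

Variable R : realType.

Lemma ptws_continuous (X : topologicalType) (T : finType) (A : set X)
    (f : X -> {ptws T -> R}) :
  (forall t, {within A, continuous (fun x => f x t)}) -> {within A, continuous f}.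
Proof.
move=> cf; rewrite subspace_continuousP => x Ax.
have FF : Filter (f @ within A (nbhs x)) by exact: fmap_filter.
apply/cvg_sup => t; apply/cvg_image.
  by rewrite eqEsubset; split => // y _; exists (fun=> y).
move/subspace_continuousP: (cf t) => /(_ x Ax) cft P nP /=.
exists [set g | P (g t)]; first exact: cft.
rewrite eqEsubset; split => [y [g Pg <-]//|y Py].
by exists (fun=> y).
Qed.

Lemma ptws_eval_continuous (T : finType) (t : T) :
  continuous (fun x : {ptws T -> R} => x t).
Proof. by move=> x; exact: (@proj_continuous T (fun=> R) t x). Qed.

End WithinContinuous.

Section Homotopies.
Import Order.TTheory GRing.Theory Num.Theory.
Import numFieldNormedType.Exports.
Local Open Scope classical_set_scope.
Local Open Scope ring_scope.
Variable R : realType.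

Lemma closed_leq_continuous (X : topologicalType) (f : X -> R) (c : R) :
  continuous f -> closed [set x | f x <= c].
Proof.
move=> cf; apply: (@preimage_closed _ _ f [set x | x <= c]).
  by move=> x _; exact: cf.
exact: closed_le.
Qed.

Lemma closed_geq_continuous (X : topologicalType) (f : X -> R) (c : R) :
  continuous f -> closed [set x | c <= f x].
Proof.
move=> cf; apply: (@preimage_closed _ _ f [set x | c <= x]).
  by move=> x _; exact: cf.
exact: closed_ge.
Qed.

Lemma closed_eq_continuous (X : topologicalType) (f : X -> R) (c : R) :
  continuous f -> closed [set x | f x = c].
Proof.
move=> cf; apply: (@preimage_closed _ _ f [set x | x = c]).
  by move=> x _; exact: cf.
exact: closed_eq.
Qed.

Lemma unit_cylinderP (X : Type) (A : set X) (z : R * X) :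
  (`[0, 1] `*` A) z <-> 0 <= z.1 <= 1 /\ A z.2.
Proof. by rewrite /= in_itv. Qed.

Lemma homotopic_sym (X Y : topologicalType) (A : set X) (B : set Y)
    (f g : X -> Y) :
  homotopic R A B f g -> homotopic R A B g f.
Proof.
move=> [H [[HB cH] H0 H1]]; exists (fun z => H (1 - z.1, z.2)); split.
- have H01 z : (`[0, 1] `*` A) z -> (`[(0 : R), 1] `*` A) (1 - z.1, z.2).
    by move=> /unit_cylinderP[tI Ax]; apply/unit_cylinderP; split => //=; lra.
  split=> [z /H01 /HB//|].
  apply: (within_continuous_to (g := H) _ H01 cH).
  apply: within_continuous_pair; apply: continuous_subspaceT => z; last exact: cvg_snd.
  by apply: cvgB; [exact: cvg_cst|exact: cvg_fst].
- by move=> x Ax; rewrite /= subr0 H1.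
- by move=> x Ax; rewrite /= subrr H0.
Qed.

Lemma homotopic_trans (X Y : topologicalType) (A : set X) (B : set Y)
    (f g h : X -> Y) :
  homotopic R A B f g -> homotopic R A B g h -> homotopic R A B f h.
Proof.
move=> [H [[HB cH] H0 H1]] [K [[KB cK] K0 K1]].
exists (fun z => if z.1 <= 2^-1 then H (2 * z.1, z.2) else K (2 * z.1 - 1, z.2)).
have low (t : R) : 0 <= t <= 1 -> t <= 2^-1 -> 0 <= 2 * t <= 1 by lra.
have high (t : R) : 0 <= t <= 1 -> 2^-1 <= t -> 0 <= 2 * t - 1 <= 1 by lra.
have IH z : ((`[0, 1] `*` A) `&` [set z | z.1 <= 2^-1]) z ->
    (`[(0 : R), 1] `*` A) (2 * z.1, z.2).
  case=> Iz /= zh; have [tI Ax] := (unit_cylinderP A z).1 Iz.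
  by apply: (unit_cylinderP A (_, _)).2; split => //=; exact: low.
have IK z : ((`[0, 1] `*` A) `&` [set z | 2^-1 <= z.1]) z ->
    (`[(0 : R), 1] `*` A) (2 * z.1 - 1, z.2).
  case=> Iz /= zh; have [tI Ax] := (unit_cylinderP A z).1 Iz.
  by apply: (unit_cylinderP A (_, _)).2; split => //=; exact: high.
split.
- split=> [z Iz|].
    by case: leP => zh; [apply/HB/IH|apply/KB/IK; split => //=; exact: ltW].
  apply: (@within_continuous_glue _ _ _ [set z : R * X | z.1 <= 2^-1]
    [set z : R * X | 2^-1 <= z.1]).
  + by apply: closed_leq_continuous => z; exact: cvg_fst.
  + by apply: closed_geq_continuous => z; exact: cvg_fst.
  + by move=> z _ /=; case: (leP z.1 2^-1) => [|/ltW]; [left|right].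
  + apply: (@within_continuous_eq _ _ _ (fun z : R * X => H (2 * z.1, z.2))).
      by move=> z [_ /= ->].
    apply: (within_continuous_to (g := H) _ IH cH).
    apply: within_continuous_pair; apply: continuous_subspaceT => z; last exact: cvg_snd.
    by apply: cvgM; [exact: cvg_cst|exact: cvg_fst].
  + apply: (@within_continuous_eq _ _ _ (fun z : R * X => K (2 * z.1 - 1, z.2))).
      move=> z [[_ Az] /= zh]; case: ifP => // zh'.
      have -> : z.1 = 2^-1 by lra.
      by rewrite mulfV ?pnatr_eq0// subrr K0// H1.
    apply: (within_continuous_to (g := K) _ IK cK).
    apply: within_continuous_pair; apply: continuous_subspaceT => z; last exact: cvg_snd.
    by apply: cvgB; [apply: cvgM; [exact: cvg_cst|exact: cvg_fst]|exact: cvg_cst].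
- by move=> x Ax; rewrite /= invr_ge0 ler0n mulr0 H0.
- move=> x Ax; rewrite /= ifF; last first.
    by apply/negbTE; rewrite -ltNge; have : (2^-1 : R) < 1 by lra.
  have -> : 2 * 1 - 1 = 1 :> R by lra.
  exact: K1.
Qed.

Lemma homotopic_comp (X Y Z W : topologicalType) (A : set X) (B : set Y)
    (C : set Z) (D : set W) (h : X -> Y) (f g : Y -> Z) (k : Z -> W) :
  continuous_map A B h -> homotopic R B C f g -> continuous_map C D k ->
  homotopic R A D (k \o f \o h) (k \o g \o h).
Proof.
move=> [hAB ch] [H [[HB cH] H0 H1]] [kCD ck].
exists (fun z => k (H (z.1, h z.2))); split.
- have Ih z : (`[0, 1] `*` A) z -> (`[(0 : R), 1] `*` B) (z.1, h z.2).
    by move=> /unit_cylinderP[tI Ax]; apply/unit_cylinderP; split => //=; exact: hAB.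
  split=> [z /Ih /HB /kCD//|].
  apply: (within_continuous_to (f := fun z => H (z.1, h z.2)) _ _ ck).
    apply: (within_continuous_to (g := H) _ Ih cH).
    apply: within_continuous_pair; first by apply: continuous_subspaceT => z; exact: cvg_fst.
    apply: (within_continuous_to (B := A) (g := h)) => //; last by move=> z [].
    by apply: continuous_subspaceT => z; exact: cvg_snd.
  by move=> z /Ih/HB.
- by move=> x Ax; rewrite /= H0//; exact: hAB.
- by move=> x Ax; rewrite /= H1//; exact: hAB.
Qed.

Lemma homotopic_ext (X Y : topologicalType) (A : set X) (B : set Y)
    (f g f' g' : X -> Y) :
  (forall x, A x -> f x = f' x) -> (forall x, A x -> g x = g' x) ->
  homotopic R A B f g -> homotopic R A B f' g'.
Proof.
move=> ff' gg' [H [cH H0 H1]]; exists H; split => // x Ax.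
  by rewrite H0// ff'.
by rewrite H1// gg'.
Qed.

(** The homotopy stays inside [A], and the point [a] makes [A] nonempty. *)
Definition contractible (X : topologicalType) (A : set X) : Prop :=
  exists2 a, A a & homotopic R A A id (fun=> a).

(** The identity deforms to [g \o f], and contracting [B] in the middle makes that map constant. *)
Lemma contractible_dominated (X Y : topologicalType) (A : set X) (B : set Y)
    (f : X -> Y) (g : Y -> X) :
  continuous_map A B f -> continuous_map B A g ->
  homotopic R A A (g \o f) id -> contractible B -> contractible A.
Proof.
move=> cf cg gf [b Bb hb]; exists (g b); first by case: cg => gB _; exact: gB.
apply: homotopic_trans (homotopic_sym gf) _.
exact: (homotopic_comp cf hb cg).
Qed.

End Homotopies.

(** * Order complexes *)

Section OrderComplexes.
Import Order.TTheory GRing.Theory Num.Theory.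
Import numFieldNormedType.Exports.
Local Open Scope classical_set_scope.
Local Open Scope ring_scope.
Variable R : realType.

Local Notation "'Delta' le P" := (@realization R _ (order_complex le P))
  (at level 10, le at level 9, P at level 9).

Lemma sum_neq0 (I : finType) (P : pred I) (c : I -> R) :
  \sum_(i | P i) c i != 0 -> exists2 i, P i & c i != 0.
Proof.
apply: contra_neqP => nc; apply: big1 => i Pi; apply/eqP/negPn/negP => ci.
by apply: nc; exists i.
Qed.

Lemma ler_sum_sub (I : finType) (P Q : pred I) (c : I -> R) :
  (forall i, 0 <= c i) -> subpred P Q -> \sum_(i | P i) c i <= \sum_(i | Q i) c i.
Proof.
move=> c0 PQ; rewrite [leLHS]big_mkcond [leRHS]big_mkcond /=; apply: ler_sum => i _.
by case: ifP => [/PQ ->//|_]; case: ifP.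
Qed.

Lemma sum_fibers (I J : finType) (f : I -> J) (c : I -> R) :
  \sum_j \sum_(i | f i == j) c i = \sum_i c i.
Proof. by rewrite [RHS](partition_big f xpredT). Qed.

Lemma realizationP (T : finType) (le : rel T) (P : {set T}) (x : T -> R) :
  Delta le P x <->
  [/\ forall t, 0 <= x t, \sum_t x t = 1, forall t, x t != 0 -> t \in P &
      forall s t, x s != 0 -> x t != 0 -> le s t || le t s].
Proof.
split=> [[x0 x1]|[x0 x1 xP xle]].
  rewrite inE => /and3P[_ /fintype.subsetP xP /forall_inP xle]; split => //.
    by move=> t xt; apply: xP; rewrite inE.
  move=> s t xs xt; have := xle s; rewrite inE => /(_ xs)/forall_inP/(_ t).
  by rewrite inE; exact.
split => //; rewrite inE; apply/and3P; split.
- have : \sum_t x t != 0 by rewrite x1 oner_neq0.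
  by move=> /sum_neq0[t _ xt]; apply/set0Pn; exists t; rewrite inE.
- by apply/fintype.subsetP => t; rewrite inE => /xP.
- apply/forall_inP => s; rewrite inE => xs; apply/forall_inP => t; rewrite inE => xt.
  exact: xle.
Qed.

Lemma sum_continuous (X : topologicalType) (T : finType) (P : pred T)
    (f : T -> X -> R) :
  (forall t, continuous (f t)) -> continuous (fun x => \sum_(t | P t) f t x).
Proof.
move=> cf x; apply: (@cvg_big R T (fun a b : R => a + b) 0 P).
  by apply: add_continuous.
by move=> t _; exact: cf.
Qed.

Lemma realization_map_continuous (T U : finType) (f : T -> U) (A : set {ptws T -> R}) :
  {within A, continuous (@realization_map R T U f)}.
Proof.
apply: ptws_continuous => u; apply: continuous_subspaceT.
apply: (@sum_continuous _ T (fun t => f t == u) (fun t (x : {ptws T -> R}) => x t)) => t.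
exact: ptws_eval_continuous.
Qed.

Lemma realization_map_continuous_map (T U : finType) (leT : rel T) (leU : rel U)
    (P : {set T}) (Q : {set U}) (f : T -> U) :
  {in P, forall p, f p \in Q} -> {in P &, {homo f : p q / leT p q >-> leU p q}} ->
  continuous_map (Delta leT P) (Delta leU Q) (realization_map f).
Proof.
move=> fPQ f_mono; split; last exact: realization_map_continuous.
move=> x /realizationP[x0 x1 xP xle]; apply/realizationP; split.
- by move=> u; apply: sumr_ge0.
- by rewrite sum_fibers.
- by move=> u /sum_neq0[p /eqP <- xp]; apply: fPQ; exact: xP.
- move=> u v /sum_neq0[p /eqP <- xp] /sum_neq0[q /eqP <- xq].
  by case/orP: (xle p q xp xq) => /f_mono -> //; rewrite ?orbT //; exact: xP.
Qed.

Lemma realization_map_id (T : finType) (x : {ptws T -> R}) :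
  realization_map id x = x.
Proof. by apply: funext => t; rewrite /realization_map big_pred1_eq. Qed.

Lemma realization_map_supp (T U : finType) (f : T -> U) (x : {ptws T -> R}) u :
  realization_map f x u != 0 -> exists2 t, x t != 0 & f t = u.
Proof. by move=> /sum_neq0[t /eqP ftu xt]; exists t. Qed.

Lemma realization_sub (T : finType) (le : rel T) (P Q : {set T}) :
  P \subset Q -> Delta le P `<=` Delta le Q.
Proof.
move=> /fintype.subsetP PQ x /realizationP[x0 x1 xP xle]; apply/realizationP; split => //.
by move=> t /xP/PQ.
Qed.

Lemma minr_continuous (X : topologicalType) (f g : X -> R) :
  continuous f -> continuous g -> continuous (fun x => Num.min (f x) (g x)).
Proof. by move=> cf cg x; apply: continuous_min; [exact: cf|exact: cg]. Qed.

Lemma maxr_continuous (X : topologicalType) (f g : X -> R) :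
  continuous f -> continuous g -> continuous (fun x => Num.max (f x) (g x)).
Proof. by move=> cf cg x; apply: continuous_max; [exact: cf|exact: cg]. Qed.

Lemma subr_continuous (X : topologicalType) (f g : X -> R) :
  continuous f -> continuous g -> continuous (fun x => f x - g x).
Proof. by move=> cf cg x; apply: cvgB; [exact: cf|exact: cg]. Qed.

Lemma addr_continuous (X : topologicalType) (f g : X -> R) :
  continuous f -> continuous g -> continuous (fun x => f x + g x).
Proof. by move=> cf cg x; apply: cvgD; [exact: cf|exact: cg]. Qed.

(** * Homotopies between comparable monotone maps *)

Section MonotoneHomotopy.
Variables (T U : finType) (leT : rel T) (leU : rel U).
Hypotheses (leT_anti : antisymmetric leT) (leT_trans : transitive leT).
Hypothesis (leU_trans : transitive leU).

Let ltT s t := (s != t) && leT s t.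
(** Mass [z.1] is poured into the chain from its bottom: what is left after the elements strictly
    below [p] goes to [p], up to its full coordinate. *)
Let low (z : R * {ptws T -> R}) (p : T) : R :=
  Num.min (z.2 p) (Num.max 0 (z.1 - \sum_(q | ltT q p) z.2 q)).

(* The lowest part of the chain, of total mass t, moves along a and the rest
   along b. *)
Let slide (a b : T -> U) (z : R * {ptws T -> R}) : {ptws U -> R} := fun u =>
  \sum_(p | a p == u) low z p + \sum_(p | b p == u) (z.2 p - low z p).

Let snd_eval_continuous q : continuous (fun z : R * {ptws T -> R} => z.2 q).
Proof.
move=> z; apply: (@continuous_comp _ _ _ snd (fun x : {ptws T -> R} => x q)).
  exact: cvg_snd.
exact: ptws_eval_continuous.
Qed.

Let low_continuous p : continuous (fun z => low z p).
Proof.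
apply: minr_continuous; first exact: snd_eval_continuous.
apply: (@maxr_continuous _ (fun=> 0)
  (fun z : R * {ptws T -> R} => z.1 - \sum_(q | ltT q p) z.2 q)).
  by move=> z; exact: (@cst_continuous (R * {ptws T -> R})%type R 0).
apply: (@subr_continuous _ (fun (z : R * {ptws T -> R}) => z.1)
  (fun (z : R * {ptws T -> R}) => \sum_(q | ltT q p) z.2 q)).
  by move=> z; exact: cvg_fst.
apply: (@sum_continuous _ T (fun q => ltT q p) (fun q (z : R * {ptws T -> R}) => z.2 q)).
exact: snd_eval_continuous.
Qed.

Let slide_continuous a b : continuous_map setT setT (slide a b).
Proof.
split=> //; apply: ptws_continuous => u; apply: continuous_subspaceT.
apply: (@addr_continuous _ (fun (z : R * {ptws T -> R}) => \sum_(p | a p == u) low z p)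
  (fun (z : R * {ptws T -> R}) => \sum_(p | b p == u) (z.2 p - low z p))).
  exact: (@sum_continuous _ T (fun p => a p == u) (fun p (z : R * {ptws T -> R}) => low z p)).
apply: (@sum_continuous _ T (fun p => b p == u) (fun p (z : R * {ptws T -> R}) => z.2 p - low z p)) => p.
apply: (@subr_continuous _ (fun (z : R * {ptws T -> R}) => z.2 p) (low^~ p)); first exact: snd_eval_continuous.
exact: low_continuous.
Qed.

(** A straight-line homotopy would leave the complex, since [a p] and [b q] need not be comparable
    when [q] lies below [p]. Moving mass from the bottom up uses [a] only on a lower part of the
    chain and [b] only on an upper part, and [p <= q] gives [a p <= a q <= b q]. *)
Lemma homotopic_of_le (P : {set T}) (Q : {set U}) (a b : T -> U) :
  {in P, forall p, a p \in Q} -> {in P, forall p, b p \in Q} ->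
  {in P &, {homo a : p q / leT p q >-> leU p q}} ->
  {in P &, {homo b : p q / leT p q >-> leU p q}} ->
  {in P, forall p, leU (a p) (b p)} ->
  homotopic R (Delta leT P) (Delta leU Q) (realization_map a) (realization_map b).
Proof.
move=> aQ bQ a_mono b_mono ab; apply: homotopic_sym.
exists (slide a b); split; first split.
- move=> [t x] /unit_cylinderP[/= tI /realizationP[x0 x1 xP xle]].
  have low0 p : 0 <= low (t, x) p by rewrite /low /= le_min x0 le_max lexx.
  have lowx p : low (t, x) p <= x p by rewrite /low /= ge_min lexx.
  have lt_sum p q : ltT p q -> \sum_(s | ltT s p) x s + x p <= \sum_(s | ltT s q) x s.
    move=> pq; rewrite [leRHS](bigD1 p)//= [leLHS]addrC lerD2l.
    apply: ler_sum_sub => // s /andP[sp les].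
    case/andP: pq => neq lepq; rewrite /ltT sp (leT_trans les lepq) !andbT.
    by apply: contraNneq neq => sq; rewrite -sq in lepq *; rewrite (leT_anti (x := s) (y := p)) ?les.
  have cases u : slide a b (t, x) u != 0 ->
      (exists p, [/\ x p != 0, low (t, x) p != 0 & a p = u]) \/
      (exists p, [/\ x p != 0, x p != low (t, x) p & b p = u]).
    move=> su; case: (eqVneq (\sum_(p | a p == u) low (t, x) p) 0) => [la|/sum_neq0[p /eqP pu lp]].
      move: su; rewrite /slide la add0r => /sum_neq0[p /eqP pu lp]; right; exists p.
      split=> //; last by rewrite -subr_eq0.
      apply: contraNneq lp => xp; have := low0 p; have := lowx p; rewrite /= xp => ? ?.
      by rewrite subr_eq0; apply/eqP/le_anti/andP.
    left; exists p; split => //; apply: contraNneq lp => xp.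
    by have := low0 p; have := lowx p; rewrite xp => ? ?; apply/eqP/le_anti/andP.
  apply/realizationP; split.
  + by move=> u; apply: addr_ge0; apply: sumr_ge0 => p _ //; rewrite subr_ge0.
  + rewrite /slide big_split /= !sum_fibers -big_split /= -[RHS]x1.
    by apply: eq_bigr => p _; rewrite addrC subrK.
  + by move=> u /cases[[p [xp _ <-]]|[p [xp _ <-]]]; [apply: aQ|apply: bQ]; exact: xP.
  + have cross p q : x p != 0 -> x q != 0 -> low (t, x) p != 0 ->
        x q != low (t, x) q -> leU (a p) (b q).
      move=> xp xq lp lq; have [pP qP] := (xP p xp, xP q xq).
      have [pq|npq] := boolP (leT p q).
        by apply: leU_trans (ab _ qP); exact: a_mono.
      (* If [q] is strictly below [p], then mass reaching [p] means that less than [t] lies below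
         [p], while [q] not being filled means that more than [t] lies at or below [q]; [lt_sum]
         excludes this. *)
      have qp : ltT q p.
        have /orP[|lqp] := xle p q xp xq; first by rewrite (negPf npq).
        by rewrite /ltT lqp andbT; apply: contraNneq npq => <-; rewrite -(orbb (leT q q)) xle.
      have xp0 : 0 < x p by rewrite lt_neqAle eq_sym xp x0.
      have sp : \sum_(s | ltT s p) x s < t.
        rewrite ltNge; apply: contraNN lp => tp; rewrite /low /=.
        by rewrite max_l ?subr_le0// min_r.
      have sq : t < \sum_(s | ltT s q) x s + x q.
        rewrite ltNge; apply: contraNN lq => tq; rewrite /low /=.
        by rewrite min_l// le_max; apply/orP; right; rewrite lerBrDl.
      by have := lt_sum _ _ qp; lra.
    move=> u v /cases[[p [xp lp <-]]|[p [xp lp <-]]] /cases[[q [xq lq <-]]|[q [xq lq <-]]].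
    * by case/orP: (xle _ _ xp xq) => /a_mono -> //; rewrite ?orbT//; exact: xP.
    * by rewrite cross.
    * by rewrite orbC cross.
    * by case/orP: (xle _ _ xp xq) => /b_mono -> //; rewrite ?orbT//; exact: xP.
- by apply: continuous_subspaceW (slide_continuous a b).2.
- move=> x /realizationP[x0 x1 _ _]; apply: funext => u.
  have low_0 p : low (0, x) p = 0.
    by rewrite /low /= sub0r max_l ?oppr_le0 ?sumr_ge0// min_r.
  rewrite /slide big1 ?add0r => [|p _]; last exact: low_0.
  by apply: eq_bigr => p _; rewrite low_0 subr0.
- move=> x /realizationP[x0 x1 _ _]; apply: funext => u.
  have low_1 p : low (1, x) p = x p.
    rewrite /low /= min_l// le_max; apply/orP; right.
    rewrite lerBrDl -x1 [leRHS](bigID (ltT^~ p)) /= lerD2l.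
    by rewrite (bigD1 p) /= ?/ltT ?eqxx// lerDl sumr_ge0.
  rewrite /slide [X in _ + X]big1 ?addr0 => [|p _]; last by rewrite low_1 subrr.
  by apply: eq_bigr => p _; rewrite low_1.
Qed.

End MonotoneHomotopy.
End OrderComplexes.

(** * Carriers *)

Section Carriers.
Import Order.TTheory GRing.Theory Num.Theory.
Import numFieldNormedType.Exports.
Local Open Scope classical_set_scope.
Local Open Scope ring_scope.
Variable R : realType.

Local Notation "'Delta' le P" := (@realization R _ (order_complex le P))
  (at level 10, le at level 9, P at level 9).

Definition supp_ge (T : finType) (le : rel T) (p : T) (x : T -> R) : Prop :=
  forall t, x t != 0 -> le p t.

Section AddMinimalVertex.
Variables (X : topologicalType) (T : finType) (le : rel T).
Hypotheses (le_refl : reflexive le).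
Variables (C : {set T}) (q : T).
Hypothesis q_min : forall t, t \in C -> le t q -> t = q.
Variables (V : set X) (g : {ptws T -> R} -> X).
Hypothesis cg : {within Delta le (C :\ q)%SET, continuous g}.
Hypothesis gV : forall x, Delta le (C :\ q)%SET x -> supp_ge le q x -> V (g x).
Variables (h : R * X -> X) (a : X).
Hypothesis hV : continuous_map ((`[0, 1] : set R) `*` V) V h.
Hypothesis h0 : forall y, V y -> h (0, y) = y.
Hypothesis h1 : forall y, V y -> h (1, y) = a.
Hypothesis Va : V a.

Let away (x : {ptws T -> R}) : {ptws T -> R} :=
  fun t => if t == q then 0 else x t / (1 - x q).

(** The equation describes the star of [q]; a sum of nonnegative terms set to zero is a closed
    condition, as gluing requires. The bound on [x q] keeps the denominator in [away] at least
    1/2. *)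
Let near_part : set {ptws T -> R} :=
  (Delta le C `&` [set x | \sum_(t | ~~ le q t) x t = 0]) `&` [set x | x q <= 2^-1].

Definition cone_extension (x : {ptws T -> R}) : X :=
  if x q == 0 then g x else
  if 2^-1 <= x q then a else h (2 * x q, g (away x)).

Let away_in x : near_part x -> Delta le (C :\ q)%SET (away x) /\ supp_ge le q (away x).
Proof.
move=> [[/realizationP[x0 x1 xC xle] /= xq] xh].
have x1q : 0 < 1 - x q by move: xh => /=; lra.
have supp t : away x t != 0 -> t != q /\ x t != 0.
  rewrite /away; case: (eqVneq t q) => [_|tq]; first by move/eqP.
  by move=> xt; split => //; apply: contraNneq xt => ->; rewrite mul0r.
split; last first.
  move=> t /supp[tq xt]; apply: contraNT xt => nqt.
  by have /eqP := xq; rewrite psumr_eq0// => /allP/(_ t); rewrite mem_index_enum nqt => /(_ isT).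
apply/realizationP; split.
- by move=> t; rewrite /away; case: ifP => // _; apply: divr_ge0 => //; exact: ltW.
- rewrite (bigD1 q)//= {1}/away eqxx add0r.
  transitivity (\sum_(t | t != q) x t / (1 - x q)).
    by apply: eq_bigr => t /negPf tq; rewrite /away tq.
  rewrite -mulr_suml; have <- : 1 - x q = \sum_(t | t != q) x t by rewrite -x1 (bigD1 q)//= addrC addrK.
  by rewrite divff// lt0r_neq0.
- by move=> t /supp[tq xt]; rewrite !inE tq; exact: xC.
- by move=> s t /supp[_ xs] /supp[_ xt]; exact: xle.
Qed.

Let away_continuous : {within near_part, continuous away}.
Proof.
apply: ptws_continuous => t; rewrite /away.
have [tq|tq] := eqVneq t q.
  by apply: continuous_subspaceT => x; exact: (@cst_continuous {ptws T -> R} R 0).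
rewrite subspace_continuousP => x [_ xh]; apply: cvg_within_filter.
have x1q : 1 - x q != 0.
  by apply: lt0r_neq0; move: xh => /=; lra.
apply: (@cvgM R {ptws T -> R} (nbhs x) _ (fun x => x t) (fun x => (1 - x q)^-1)).
  exact: ptws_eval_continuous.
apply: (@cvgV R {ptws T -> R} (nbhs x) _ (fun x => 1 - x q)) => //.
apply: (@subr_continuous R {ptws T -> R} (fun=> 1) (fun x => x q)).
  by move=> y; exact: (@cst_continuous {ptws T -> R} R 1).
exact: ptws_eval_continuous.
Qed.

Let near_value x : near_part x -> cone_extension x = h (2 * x q, g (away x)).
Proof.
move=> nx; have [ax aq] := away_in nx.
rewrite /cone_extension; case: (eqVneq (x q) 0) => [xq|_].
  rewrite xq mulr0 h0; last exact: gV.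
  congr g; apply: funext => t; rewrite /away xq subr0 divr1.
  by case: eqVneq => [->|].
case: ifP => // xq; have -> : x q = 2^-1.
  by apply: le_anti; rewrite xq andbT; case: nx.
by rewrite divff ?pnatr_eq0// h1//; exact: gV.
Qed.

(** Minimality of [q] puts every chain through [q] into its star, so the star and the set [x q = 0]
    are closed and cover [Delta C]; the star is cut again at height 1/2. The pieces agree because
    [h] starts at the identity and ends at [a]. *)
Lemma cone_extension_continuous : {within Delta le C, continuous cone_extension}.
Proof.
apply: (@within_continuous_glue _ _ _ [set x : {ptws T -> R} | x q = 0]
  [set x : {ptws T -> R} | \sum_(t | ~~ le q t) x t = 0]).
- exact: (closed_eq_continuous (f := fun x : {ptws T -> R} => x q) (@ptws_eval_continuous _ _ _)).
- apply: (closed_eq_continuous (f := fun x : {ptws T -> R} => \sum_(t | ~~ le q t) x t)).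
  apply: (@sum_continuous _ _ T (fun t => ~~ le q t) (fun t (x : {ptws T -> R}) => x t)) => t.
  exact: ptws_eval_continuous.
- move=> x /realizationP[x0 x1 xC xle] /=; case: (eqVneq (x q) 0) => [|xq]; first by left.
  right; apply: big1 => t nqt; apply/eqP; apply: contraNT nqt => xt.
  have /orP[//|tq] := xle q t xq xt.
  by rewrite (q_min (xC t xt) tq).
- apply: (@within_continuous_eq _ _ _ g) => [x [_ /= xq]|].
    by rewrite /cone_extension xq eqxx.
  apply: continuous_subspaceW cg => x [/realizationP[x0 x1 xC xle] /= xq].
  apply/realizationP; split => // t xt; rewrite !inE xC// andbT.
  by apply: contraNneq xt => ->; rewrite xq.
apply: (@within_continuous_glue _ _ _ [set x : {ptws T -> R} | x q <= 2^-1]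
  [set x : {ptws T -> R} | 2^-1 <= x q]).
- exact: (closed_leq_continuous (f := fun x : {ptws T -> R} => x q) (@ptws_eval_continuous _ _ _)).
- exact: (closed_geq_continuous (f := fun x : {ptws T -> R} => x q) (@ptws_eval_continuous _ _ _)).
- by move=> x _ /=; case: (leP (x q) 2^-1) => [|/ltW]; [left|right].
- apply: (@within_continuous_eq _ _ _ (fun x : {ptws T -> R} => h (2 * x q, g (away x)))).
    by move=> x /near_value.
  case: hV => _ ch; apply: (within_continuous_to (g := h) _ _ ch); last first.
    move=> x nx; have [ax aq] := away_in nx; apply: (unit_cylinderP V (_, _)).2; split; last exact: gV.
    case: nx => [[/realizationP[x0 _ _ _] _] xh] /=.
    by move: xh (x0 q) => /=; lra.
  apply: within_continuous_pair.
    apply: continuous_subspaceT => x.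
    apply: (@cvgM R {ptws T -> R} (nbhs x) _ (fun=> 2) (fun x => x q)).
      exact: (@cst_continuous {ptws T -> R} R 2).
    exact: ptws_eval_continuous.
  apply: (within_continuous_to away_continuous _ cg) => x nx.
  by case: (away_in nx).
- apply: (@within_continuous_eq _ _ _ (fun=> a)).
    move=> x [_ /= xq]; rewrite /cone_extension xq; case: eqVneq => // xq0.
    by move: xq; rewrite xq0 invr_le0 lern0.
  by apply: continuous_subspaceT => x; exact: cst_continuous.
Qed.

Lemma cone_extension_away x : x q = 0 -> cone_extension x = g x.
Proof. by rewrite /cone_extension => ->; rewrite eqxx. Qed.

Lemma cone_extension_in x : Delta le C x -> x q != 0 -> V (cone_extension x).
Proof.
move=> Dx xq; rewrite /cone_extension (negPf xq); case: leP => // /ltW xh.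
have nx : near_part x.
  split=> //; split=> //=; case/realizationP: Dx => x0 x1 xC xle.
  apply: big1 => t nqt; apply/eqP; apply: contraNT nqt => xt.
  have /orP[//|tq] := xle q t xq xt.
  by rewrite (q_min (xC t xt) tq).
rewrite -(_ : cone_extension x = h (2 * x q, g (away x))); last exact: near_value.
rewrite near_value//; have [ax aq] := away_in nx.
case: hV => hVV _; apply: hVV; apply: (unit_cylinderP V (_, _)).2; split; last exact: gV.
case/realizationP: Dx => x0 _ _ _ /=.
by have := x0 q; lra.
Qed.

End AddMinimalVertex.

(* The vertices of B \ A are added one at a time, each minimal among those
   present, so that each step is the extension of a map to a cone. *)
Lemma carried_extension (X : topologicalType) (T : finType) (le : rel T)
    (A B : {set T}) (W : set X) (U : T -> set X) (g : {ptws T -> R} -> X) :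
  reflexive le -> antisymmetric le -> transitive le ->
  A \subset B -> (forall a b, a \in A -> b \in B -> le a b -> b \in A) ->
  {in B, forall q, contractible R (U q)} ->
  {in B, forall q, U q `<=` W} ->
  {in B &, forall p q, le p q -> U q `<=` U p} ->
  continuous_map (Delta le A) W g ->
  (forall x p, Delta le A x -> p \in B -> supp_ge le p x -> U p (g x)) ->
  exists g', [/\ continuous_map (Delta le B) W g',
    forall x p, Delta le B x -> p \in B -> supp_ge le p x -> U p (g' x) &
    forall x, Delta le A x -> g' x = g x].
Proof.
move=> le_refl le_anti le_trans AB A_up U_contr UW U_anti cg gU.
suff ext n (C : {set T}) : #|C :\: A|%SET = n -> A \subset C -> C \subset B ->
    (forall a b, a \in C -> b \in B -> le a b -> b \in C) ->
    exists g', [/\ continuous_map (Delta le C) W g',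
      forall x p, Delta le C x -> p \in B -> supp_ge le p x -> U p (g' x) &
      forall x, Delta le A x -> g' x = g x].
  by apply: (ext _ B erefl).
elim: n C => [C /eqP|n IHn C Cn AC CB C_up].
  rewrite cards_eq0 finset.setD_eq0 => CA AC _ _.
  have -> : C = A by apply/eqP; rewrite finset.eqEsubset CA.
  by exists g.
have [q0 q0D] : exists q0, q0 \in (C :\: A)%SET by apply/set0Pn; rewrite -card_gt0 Cn.
pose q := [arg min_(q < q0 in (C :\: A)%SET) #|[set t in (C :\: A)%SET | le t q]|]%SET.
have [qD q_least] : q \in (C :\: A)%SET /\ (forall t, t \in (C :\: A)%SET -> 
    #|[set s in (C :\: A)%SET | le s q]%SET| <= #|[set s in (C :\: A)%SET | le s t]%SET|)%N.
  by rewrite /q; case: arg_minnP.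
have [qC qA] : q \in C /\ q \notin A by move: qD; rewrite inE => /andP[].
(* Nothing of [A] lies below [q], since [A] is upward closed in [B] and [q] is outside it; so
   minimality in [C :\: A] gives minimality in [C]. *)
have q_min t : t \in C -> le t q -> t = q.
  move=> tC tq; have [tA|tA] := boolP (t \in A).
    by rewrite (A_up t q) ?(fintype.subsetP CB) in qA.
  apply/eqP/negPn/negP => tq'.
  have tD : t \in (C :\: A)%SET by rewrite inE tA.
  have := q_least t tD; rewrite leqNgt => /negP; apply; apply: proper_card.
  apply/fintype.properP; split.
    apply/fintype.subsetP => s; rewrite !inE => /andP[-> st].
    by rewrite (le_trans t).
  exists q; first by rewrite !inE qA qC le_refl.
  rewrite !inE qA qC /=; apply: contraNN tq' => qt.
  by apply/eqP/le_anti; rewrite tq.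
have qB : q \in B by exact: (fintype.subsetP CB).
have [||||g' [cg' g'U g'g]] := IHn (C :\ q)%SET.
- by apply/eqP; rewrite -eqSS -Cn (cardsD1 q (C :\: A)%SET) qD finset.setDDl finset.setUC -finset.setDDl.
- by apply/fintype.subsetP => t tA; rewrite !inE (fintype.subsetP AC)// andbT; apply: contraNneq qA => <-.
- by apply: fintype.subset_trans CB; exact: finset.subD1set.
- move=> s b; rewrite !inE => /andP[sq sC] bB sb; rewrite (C_up s)// andbT.
  by apply: contraNneq sq => bq; apply/eqP/q_min => //; rewrite -bq.
have [a Ua [h [hU h0 h1]]] := U_contr q qB.
have gV x : Delta le (C :\ q)%SET x -> supp_ge le q x -> U q (g' x).
  by move=> Dx; apply: g'U.
exists (cone_extension q g' h a).
have Dsub x : Delta le C x -> x q = 0 -> Delta le (C :\ q)%SET x.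
  move=> /realizationP[x0 x1 xC xle] xq; apply/realizationP; split => // t xt.
  by rewrite !inE xC// andbT; apply: contraNneq xt => ->; rewrite xq.
split.
- split; last exact: (cone_extension_continuous le_refl q_min cg'.2 gV hU h0 h1).
  move=> x Dx; have [xq|xq] := eqVneq (x q) 0.
    rewrite cone_extension_away//; case: cg' => g'W _; apply: g'W; exact: Dsub.
  by apply: (UW q qB); apply: (cone_extension_in (V := U q) _ _ gV).
- move=> x p Dx pB xp; have [xq|xq] := eqVneq (x q) 0.
    by rewrite cone_extension_away//; apply: g'U => //; exact: Dsub.
  (* A point with mass at [q] and support above [p] has [p <= q], so its image in [U q] lies in
     [U p]. *)
  apply: (U_anti p q) => //; first exact: xp.
  by apply: (cone_extension_in le_refl q_min gV hU h0 h1).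
- move=> x Ax; rewrite cone_extension_away ?g'g//.
  case/realizationP: Ax => _ _ xA _; apply/eqP; apply: contraNT qA; exact: xA.
Qed.

End Carriers.

(** * Homotopies of carried maps and a fiber lemma *)

Section FiberTheorem.
Import Order.TTheory GRing.Theory Num.Theory.
Import numFieldNormedType.Exports.
Local Open Scope classical_set_scope.
Local Open Scope ring_scope.
Variable R : realType.

Local Notation "'Delta' le P" := (@realization R _ (order_complex le P))
  (at level 10, le at level 9, P at level 9).

Lemma sign_le_refl : reflexive sign_le.
Proof. by move=> a; rewrite /sign_le eqxx orbT. Qed.

Lemma sign_le_anti : antisymmetric sign_le.
Proof. by case=> [[]|] [[]|]. Qed.

Lemma sign_le_trans : transitive sign_le.
Proof. by case=> [[]|] [[]|] [[]|]. Qed.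

(* The maps are prescribed on the layers + and - of T x {+, 0, -} and extended to
   the layer 0, through which the homotopy passes. *)
Lemma carried_homotopic (X : topologicalType) (T : finType) (le : rel T)
    (P : {set T}) (W : set X) (V : T -> set X) (g0 g1 : {ptws T -> R} -> X) :
  reflexive le -> antisymmetric le -> transitive le ->
  {in P, forall p, contractible R (V p)} ->
  {in P, forall p, V p `<=` W} ->
  {in P &, forall p q, le p q -> V q `<=` V p} ->
  continuous_map (Delta le P) W g0 -> continuous_map (Delta le P) W g1 ->
  (forall x p, Delta le P x -> p \in P -> supp_ge le p x ->
    V p (g0 x) /\ V p (g1 x)) ->
  homotopic R (Delta le P) W g0 g1.
Proof.
move=> le_refl le_anti le_trans V_contr VW V_anti cg0 cg1 gV.
pose le2 : rel (T * option bool) := fun z w => le z.1 w.1 && sign_le z.2 w.2.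
have le2_refl : reflexive le2 by move=> z; rewrite /le2 le_refl sign_le_refl.
have le2_anti : antisymmetric le2.
  move=> [s a] [t b] /andP[/andP[/= st ab] /andP[/= ts ba]].
  by rewrite (le_anti s t) ?st// (sign_le_anti (x := a) (y := b)) ?ab.
have le2_trans : transitive le2.
  move=> z w v /andP[wz1 wz2] /andP[zv1 zv2]; apply/andP; split.
    exact: le_trans zv1.
  exact: sign_le_trans zv2.
pose layer b : T -> T * option bool := fun t => (t, b).
pose B := [set z : T * option bool | z.1 \in P]%SET.
pose A := [set z in B | z.2 != None]%SET.
pose slice b (y : {ptws (T * option bool) -> R}) : {ptws T -> R} := fun t => y (t, Some b).
pose g (y : {ptws (T * option bool) -> R}) : X :=
  if \sum_t slice true y t == 0 then g0 (slice false y) else g1 (slice true y).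
have layer_mono b : {in P &, {homo layer b : p q / le p q >-> le2 p q}}.
  by move=> p q _ _ pq; rewrite /le2 /= pq sign_le_refl.
(* As + and - are incomparable, no chain of [A] meets both layers: [Delta A] is the disjoint union
   of two closed copies of [Delta P], and [g] may be given on each separately. *)
have slice_dich y b : Delta le2 A y -> \sum_t slice b y t != 0 ->
    forall t, slice (~~ b) y t = 0.
  move=> /realizationP[y0 y1 yA yle] /sum_neq0[s _ ys] t; apply/eqP/negPn/negP => yt.
  by have := yle _ _ ys yt; rewrite /le2 /=; case: (b); rewrite !andbF.
have slice_sum y : Delta le2 A y ->
    \sum_t slice true y t + \sum_t slice false y t = 1.
  move=> /realizationP[y0 y1 yA yle]; rewrite -big_split -y1.
  rewrite (eq_bigr (fun z => y (z.1, z.2))); last by move=> [].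
  rewrite -(pair_bigA _ (fun t o => y (t, o))) /=; apply: eq_bigr => t _.
  rewrite (bigD1 (Some true))//= (bigD1 (Some false))//= big1 ?addr0//.
  move=> [[]|] //= _; apply/eqP/negPn/negP => /yA; by rewrite inE andbF.
have slice_in y b : Delta le2 A y -> \sum_t slice b y t != 0 ->
    Delta le P (slice b y).
  move=> Dy yb; have sl0 := slice_dich _ _ Dy yb; have := slice_sum y Dy.
  case/realizationP: Dy => y0 y1 yA yle s1; apply/realizationP; split.
  - by move=> t; exact: y0.
  - case: (b) sl0 => /= sl0; rewrite -s1; last by rewrite [X in X + _]big1 ?add0r.
    by rewrite [X in _ + X]big1 ?addr0.
  - by move=> t /yA; rewrite !inE => /andP[].
  - by move=> s t ys yt; have := yle _ _ ys yt; rewrite /le2 /= sign_le_refl !andbT.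
have sliceC y b : Delta le2 A y -> \sum_t slice b y t = 0 ->
    \sum_t slice (~~ b) y t != 0.
  move=> Dy yb; have := slice_sum y Dy; case: (b) yb => -> /=.
    by rewrite add0r => ->; exact: oner_neq0.
  by rewrite addr0 => ->; exact: oner_neq0.
have gE y b : Delta le2 A y -> \sum_t slice (~~ b) y t = 0 ->
    g y = (if b then g1 else g0) (slice b y).
  move=> Dy yb; have := sliceC _ _ Dy yb; rewrite negbK /g.
  by case: (b) yb => [_|->]; [case: eqVneq|rewrite eqxx].
have slice_continuous b D : {within D, continuous (slice b)}.
  by apply: ptws_continuous => t; apply: continuous_subspaceT; exact: ptws_eval_continuous.
have slice_sum_continuous b : continuous (fun y => \sum_t slice b y t).
  apply: (@sum_continuous _ _ T xpredT (fun t y => slice b y t)) => t.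
  exact: ptws_eval_continuous.
have cg b : continuous_map (Delta le P) W (if b then g1 else g0) by case: b.
have [|||||||G [cG GV Gg]] := @carried_extension R X _ le2 A B W (fun z => V z.1) g
    le2_refl le2_anti le2_trans.
- by apply/fintype.subsetP => z; rewrite inE => /andP[].
- move=> [s a] [t b]; rewrite !inE /le2 /= => /andP[_ aN] ->.
  by case: a aN => // a _; case: b => //; rewrite andbF.
- by move=> z; rewrite inE => /V_contr.
- by move=> z; rewrite inE => /VW.
- by move=> z w; rewrite !inE => zP wP /andP[zw _]; exact: V_anti.
- split=> [y Dy|].
    have [b yb] : exists b, \sum_t slice (~~ b) y t = 0.
      have [y1|y1] := eqVneq (\sum_t slice true y t) 0; first by exists false.
      by exists true; apply: big1 => t _; exact: slice_dich Dy y1 t.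
    rewrite (gE y b)//; case: (cg b) => gW _; apply: gW; apply: slice_in => //.
    by rewrite -[b]negbK; apply: sliceC.
  have cont_slice b : {within Delta le2 A `&` [set y | \sum_t slice (~~ b) y t = 0],
      continuous g}.
    apply: (@within_continuous_eq _ _ _ (fun y => (if b then g1 else g0) (slice b y))).
      by move=> y [Dy /= yb]; rewrite (gE y b).
    apply: (within_continuous_to (slice_continuous b _) _ (cg b).2) => y [Dy yb].
    by apply: slice_in => //; rewrite -[b]negbK; apply: sliceC.
  apply: (@within_continuous_glue _ _ _ [set y | \sum_t slice (~~ true) y t = 0]
    [set y | \sum_t slice (~~ false) y t = 0]).
  + by apply: closed_eq_continuous; exact: slice_sum_continuous.
  + by apply: closed_eq_continuous; exact: slice_sum_continuous.
  + move=> y Dy /=; have [y1|y1] := eqVneq (\sum_t slice true y t) 0; first by right.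
    by left; apply: big1 => t _; exact: slice_dich Dy y1 t.
  + exact: cont_slice.
  + exact: cont_slice.
- move=> y [p c] Dy; rewrite inE /= => pP yp.
  have [b yb] : exists b, \sum_t slice (~~ b) y t = 0.
    have [y1|y1] := eqVneq (\sum_t slice true y t) 0; first by exists false.
    by exists true; apply: big1 => t _; exact: slice_dich Dy y1 t.
  have Ds : Delta le P (slice b y).
    by apply: slice_in => //; rewrite -[b]negbK; apply: sliceC.
  have [|V0 V1] := gV _ p Ds pP.
    by move=> t /yp /andP[].
  by rewrite (gE y b)//; case: (b) V0 V1.
(* The layer 0 lies below each of the layers + and -, so the corresponding inclusions of [Delta P]
   are homotopic in the product; composing with [G] joins either given map to the same middle
   map. *)
have half b : homotopic R (Delta le P) W (if b then g1 else g0)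
    (G \o realization_map (layer None)).
  have inA x : Delta le P x -> Delta le2 A (realization_map (layer (Some b)) x).
    have [+ _] := @realization_map_continuous_map R _ _ le le2 P A (layer (Some b))
      ltac:(by move=> p pP; rewrite !inE pP) (layer_mono _).
    exact.
  have lay x : Delta le P x -> slice b (realization_map (layer (Some b)) x) = x.
    move=> _; apply: funext => t; rewrite /slice /realization_map.
    by rewrite (big_pred1 t) // => s; rewrite /layer xpair_eqE eqxx andbT.
  apply: (@homotopic_ext R _ _ _ _
    (G \o realization_map (layer (Some b)) \o id)
    (G \o realization_map (layer None) \o id)) => // [x Dx /=|].
    rewrite Gg; last exact: inA.
    rewrite (gE _ b) ?lay//; first exact: inA.
    apply: big1 => t _; rewrite /slice /realization_map big_pred0// => s.
    by rewrite /layer xpair_eqE; case: (b); rewrite andbF.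
  apply: (homotopic_comp (B := Delta le P) (C := Delta le2 B)) cG.
    by split => //; apply: continuous_subspaceT => x; exact: cvg_id.
  apply: homotopic_sym; apply: homotopic_of_le => //.
  - by move=> p pP; rewrite inE.
  - by move=> p pP; rewrite inE.
  - by move=> p pP; rewrite /le2 /= le_refl.
exact: homotopic_trans (half false) (homotopic_sym (half true)).
Qed.

Section Fibers.
Variables (T U : finType) (leT : rel T) (leU : rel U).
Hypotheses (leT_refl : reflexive leT) (leT_anti : antisymmetric leT)
  (leT_trans : transitive leT).
Hypotheses (leU_refl : reflexive leU) (leU_anti : antisymmetric leU)
  (leU_trans : transitive leU).
Variables (P : {set T}) (Q : {set U}) (f : T -> U) (S : U -> {set T}) (D : U -> {set U}).
Hypotheses (fPQ : {in P, forall p, f p \in Q})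
  (f_mono : {in P &, {homo f : p q / leT p q >-> leU p q}}).
Hypotheses (SP : {in Q, forall q, S q \subset P}) (DQ : {in Q, forall q, D q \subset Q}).
Hypotheses (S_contr : {in Q, forall q, contractible R (Delta leT (S q))})
  (D_contr : {in Q, forall q, contractible R (Delta leU (D q))}).
Hypotheses (S_anti : {in Q &, forall q q', leU q q' -> S q' \subset S q})
  (D_anti : {in Q &, forall q q', leU q q' -> D q' \subset D q}).
Hypotheses (D_self : {in Q, forall q, q \in D q}) (S_self : {in P, forall p, p \in S (f p)})
  (f_SD : {in Q, forall q p, p \in S q -> f p \in D q}).

(* A version of Quillen's fiber lemma. Its classical form is D q = [q, oo) and
   S q = f^-1 (D q). *)
Lemma fiber_homotopy_equivalence : induces_homotopy_equivalence R leT leU P Q f.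
Proof.
have cf : continuous_map (Delta leT P) (Delta leU Q) (realization_map f).
  exact: realization_map_continuous_map.
have noU (x : {ptws U -> R}) : ~ Delta leU (finset.set0) x.
  move=> /realizationP[_ x1 x0 _]; have : \sum_t x t != 0 by rewrite x1 oner_neq0.
  by move=> /sum_neq0[t _ /x0]; rewrite inE.
(* Extending from the empty complex yields an inverse map [g] that sends the simplices above [q]
   into [S q]; the constant 0 is a placeholder on an empty domain. *)
have [|||||||g [cg gS _]] := @carried_extension R _ U leU finset.set0 Q (Delta leT P)
    (fun q => Delta leT (S q)) (fun _ _ => 0) leU_refl leU_anti leU_trans.
- exact: finset.sub0set.
- by move=> q q'; rewrite inE.
- exact: S_contr.
- by move=> q qQ; apply: realization_sub; exact: SP.
- by move=> q q' qQ q'Q qq'; apply: realization_sub; exact: S_anti.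
- split=> [x /noU//|]; apply: continuous_subspaceT => x.
  exact: (@cst_continuous {ptws U -> R} {ptws T -> R} (fun=> 0)).
- by move=> x p /noU.
have carried_in (V : finType) (le : rel V) (A B : {set V}) x p : Delta le A x ->
    {in A, forall t, le p t -> t \in B} -> supp_ge le p x -> Delta le B x.
  move=> /realizationP[x0 x1 xA xle] AB xp; apply/realizationP; split => // t xt.
  by apply: AB; [exact: xA|exact: xp].
have mapS q x : q \in Q -> Delta leT (S q) x -> Delta leU (D q) (realization_map f x).
  move=> qQ Sx; have [+ _] := @realization_map_continuous_map R _ _ leT leU (S q) (D q) f
    (f_SD qQ) (fun p p' pS p'S => f_mono (fintype.subsetP (SP qQ) p pS)
      (fintype.subsetP (SP qQ) p' p'S)).
  exact.
have cgf : continuous_map (Delta leT P) (Delta leT P) (g \o realization_map f).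
  split=> [x /cf.1/cg.1//|]; exact: (within_continuous_to cf.2 cf.1 cg.2).
have cfg : continuous_map (Delta leU Q) (Delta leU Q) (realization_map f \o g).
  split=> [x /cg.1/cf.1//|]; exact: (within_continuous_to cg.2 cg.1 cf.2).
have cid (V : finType) (le : rel V) (A : {set V}) :
    continuous_map (Delta le A) (Delta le A) id.
  by split => //; apply: continuous_subspaceT => x; exact: cvg_id.
split=> //; exists g; split => //.
(* Both [g \o realization_map f] and the identity send the simplices above [p] into the contractible
   [S (f p)]. In the other composition the carrier is [D]. *)
- apply: (@carried_homotopic _ _ leT P _ (fun p => Delta leT (S (f p)))) => //.
  + by move=> p pP; apply: S_contr; exact: fPQ.
  + by move=> p pP; apply: realization_sub; apply: SP; exact: fPQ.
  + move=> p q pP qP pq; apply: realization_sub.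
    by apply: S_anti; [exact: fPQ|exact: fPQ|exact: f_mono].
  + move=> x p Px pP xp; split.
      apply: gS; [exact: cf.1|exact: fPQ|].
      move=> u /realization_map_supp[t xt <-]; apply: f_mono => //; last exact: xp.
      by case/realizationP: Px => _ _ xP _; exact: xP.
    apply: carried_in Px _ xp => t tP pt.
    apply: (fintype.subsetP (S_anti _ _ (f_mono pP tP pt))); try exact: fPQ.
    exact: S_self.
- apply: (@carried_homotopic _ _ leU Q _ (fun q => Delta leU (D q))) => //.
  + by move=> q qQ; apply: realization_sub; exact: DQ.
  + by move=> q q' qQ q'Q qq'; apply: realization_sub; exact: D_anti.
  + move=> x q Qx qQ xq; split; first by apply: mapS => //; exact: gS.
    apply: carried_in Qx _ xq => t tQ qt.
    by apply: (fintype.subsetP (D_anti qQ tQ qt)); exact: D_self.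
Qed.

End Fibers.

Lemma contractible_fibers (T U : finType) (leT : rel T) (leU : rel U)
    (P : {set T}) (Q : {set U}) (f : T -> U) :
  induces_homotopy_equivalence R leT leU P Q f ->
  contractible R (Delta leU Q) -> contractible R (Delta leT P).
Proof.
by move=> [cf [g [cg gf _]]]; exact: (contractible_dominated cf cg gf).
Qed.

(** The comparisons [id >= a <= b >= p0], with [p0] read as a constant map, give three homotopies
    between comparable maps. *)
Lemma contractible_zigzag (T : finType) (le : rel T) (P : {set T})
    (a b : T -> T) (p0 : T) :
  reflexive le -> antisymmetric le -> transitive le -> p0 \in P ->
  {in P, forall p, a p \in P} -> {in P, forall p, b p \in P} ->
  {in P &, {homo a : p q / le p q}} -> {in P &, {homo b : p q / le p q}} ->
  {in P, forall p, le (a p) p} -> {in P, forall p, le (a p) (b p)} ->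
  {in P, forall p, le p0 (b p)} ->
  contractible R (Delta le P).
Proof.
move=> le_refl le_anti le_trans p0P aP bP a_mono b_mono a_id a_b p0_b.
pose y0 : {ptws T -> R} := fun t => (t == p0)%:R.
have y0E (x : {ptws T -> R}) : Delta le P x -> realization_map (fun=> p0) x = y0.
  move=> /realizationP[_ x1 _ _]; apply: funext => t; rewrite /realization_map /y0.
  by case: (eqVneq t p0) => _; [exact: x1|rewrite big_pred0].
exists y0.
  apply/realizationP; split.
  - by move=> t; rewrite ler0n.
  - transitivity (\sum_(t | t == p0) (1 : R)); last by rewrite big_pred1_eq.
    by rewrite [RHS]big_mkcond; apply: eq_bigr => t _; rewrite /y0; case: eqP.
  - by move=> t; rewrite pnatr_eq0 eqb0 negbK => /eqP ->.
  - by move=> s t; rewrite !pnatr_eq0 !eqb0 !negbK => /eqP -> /eqP ->; rewrite le_refl.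
apply: (@homotopic_ext R _ _ _ _ (realization_map id) (realization_map (fun=> p0))).
- by move=> x _; rewrite realization_map_id.
- by move=> x /y0E.
apply: homotopic_trans (homotopic_sym (homotopic_of_le R le_anti le_trans le_trans
  (P := P) (Q := P) (a := a) (b := id) _ _ _ _ _)) _ => //.
apply: homotopic_trans (homotopic_of_le R le_anti le_trans le_trans
  (P := P) (Q := P) (a := a) (b := b) _ _ _ _ _) _ => //.
apply: homotopic_sym; apply: homotopic_of_le => // p q *; exact: le_refl.
Qed.

Lemma contractible_cone (T : finType) (le : rel T) (P : {set T}) (p0 : T) :
  reflexive le -> antisymmetric le -> transitive le -> p0 \in P ->
  {in P, forall p, le p0 p} -> contractible R (Delta le P).
Proof.
move=> le_refl le_anti le_trans p0P p0_le.
by apply: (@contractible_zigzag _ _ _ id id p0) => // p _; exact: le_refl.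
Qed.

End FiberTheorem.

(** * Sign vectors *)

Section SignVectorTheory.
Import numFieldNormedType.Exports.
Variable E : finType.
Implicit Types (X Y Z : signvec E) (Q C K : {set signvec E}).
Local Open Scope set_scope.

Lemma svleP X Y : reflect (forall f, sign_le (X f) (Y f)) (svle X Y).
Proof. exact: forallP. Qed.

Lemma svle_refl : reflexive (@svle E).
Proof. by move=> X; apply/svleP => f; exact: sign_le_refl. Qed.

Lemma svle_anti : antisymmetric (@svle E).
Proof.
move=> X Y /andP[/svleP XY /svleP YX]; apply/ffunP => f.
by apply: sign_le_anti; rewrite XY YX.
Qed.

Lemma svle_trans : transitive (@svle E).
Proof.
move=> Y X Z /svleP XY /svleP YZ; apply/svleP => f.
exact: sign_le_trans (XY f) (YZ f).
Qed.

Lemma svle0 X : svle sv0 X.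
Proof. by apply/svleP => f; rewrite ffunE. Qed.

Lemma svle_some X Y f b : svle X Y -> X f = Some b -> Y f = Some b.
Proof. by move=> /svleP/(_ f) + Xf; rewrite Xf => /eqP <-. Qed.

Lemma svle_none X Y f : svle X Y -> Y f = None -> X f = None.
Proof. by move=> /svleP/(_ f) + Yf; rewrite Yf; case: (X f). Qed.

Lemma svsepP X Y f :
  reflect (exists2 b, X f = Some b & Y f = Some (~~ b)) (f \in svsep X Y).
Proof.
rewrite inE ffunE; apply: (iffP andP) => [[]|[b -> ->]] /=; last by rewrite negbK.
by case: (X f) (Y f) => [b|] // [c|] // _ /eqP[->]; exists (~~ c); rewrite ?negbK.
Qed.

Lemma svle_compl X Y : svle X (svcomp X Y).
Proof. by apply/svleP => f; rewrite ffunE; case: (X f) => [b|] //; exact: sign_le_refl. Qed.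

Lemma svcomp_ub X Y Z : svle X Z -> svle Y Z -> svle (svcomp X Y) Z.
Proof.
by move=> /svleP XZ /svleP YZ; apply/svleP => f; rewrite ffunE; case: (X f) (XZ f).
Qed.

(** A common upper bound excludes opposite signs, so that the composition is a join. *)
Lemma svle_compr X Y Z : svle X Z -> svle Y Z -> svle Y (svcomp X Y).
Proof.
move=> /svleP XZ /svleP YZ; apply/svleP => f; rewrite ffunE.
by case: (X f) (Y f) (Z f) (XZ f) (YZ f) => [[]|] [[]|] [[]|].
Qed.

Lemma svcomp_mono Z : {homo svcomp Z : X Y / svle X Y}.
Proof.
move=> X Y /svleP XY; apply/svleP => f; rewrite !ffunE.
by case: (Z f) => // b; exact: sign_le_refl.
Qed.

(** [comp_closed] and [elim_closed] are the two covector axioms that, unlike zero and negation, pass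
    to subsets with prescribed signs. *)
Definition comp_closed Q : Prop := {in Q &, forall X Y, svcomp X Y \in Q}.

Definition elim_closed Q : Prop :=
  {in Q &, forall X Y f, f \in svsep X Y ->
    exists Z, [/\ Z \in Q, Z f = None &
                  forall g, g \notin svsep X Y -> Z g = svcomp X Y g]}.

Section PrescribedSigns.
Variables (Q : {set signvec E}) (p : pred (signvec E)) (N : E -> option bool -> Prop).
Hypothesis pN : forall X, p X <-> forall f c, N f c -> X f = c.

Lemma comp_closed_prescribed : comp_closed Q -> comp_closed [set X in Q | p X].
Proof.
move=> Qcomp X Y; rewrite !inE => /andP[XQ /pN pX] /andP[YQ /pN pY].
rewrite Qcomp//=; apply/pN => f c Nfc; rewrite ffunE (pX _ _ Nfc).
by case: c Nfc => // /pY.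
Qed.

(** A prescribed coordinate has the same value in [X] and [Y], so it is outside the separation set
    and elimination keeps it. *)
Lemma elim_closed_prescribed : elim_closed Q -> elim_closed [set X in Q | p X].
Proof.
move=> Qelim X Y; rewrite !inE => /andP[XQ pX] /andP[YQ pY] f fXY.
have [Z [ZQ Zf ZE]] := Qelim X Y XQ YQ f fXY; exists Z; split => //.
rewrite inE ZQ; apply/pN => g c Ngc.
have [Xg Yg] := ((pN X).1 pX g c Ngc, (pN Y).1 pY g c Ngc).
rewrite ZE ?ffunE ?Xg ?Yg; first by case: c {Ngc Xg Yg}.
by apply/svsepP => -[b]; rewrite Xg Yg => -> -[]; case: (b).
Qed.
End PrescribedSigns.

Section Deletion.
Variable e : E.

(** Deletion keeps the ground set and writes 0 at [e], so that all stages of the induction live in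
    one type and [svdel e] is comparable with the identity. *)
Definition svdel X : signvec E := [ffun f => if f == e then None else X f].

Lemma svdel_le X : svle (svdel X) X.
Proof. by apply/svleP => f; rewrite ffunE; case: eqP => // _; exact: sign_le_refl. Qed.

Lemma svdel_mono : {homo svdel : X Y / svle X Y}.
Proof. by move=> X Y /svleP XY; apply/svleP => f; rewrite !ffunE; case: eqP. Qed.

Lemma svdel_idem X : svdel (svdel X) = svdel X.
Proof. by apply/ffunP => f; rewrite !ffunE; case: eqP. Qed.

Lemma svdel_id X : X e = None -> svdel X = X.
Proof. by move=> Xe; apply/ffunP => f; rewrite ffunE; case: eqP => [->|]. Qed.

Lemma comp_closed_del Q : comp_closed Q -> comp_closed (svdel @: Q).
Proof.
move=> Qcomp _ _ /imsetP[X XQ ->] /imsetP[Y YQ ->]; apply/imsetP.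
by exists (svcomp X Y); [exact: Qcomp|apply/ffunP => f; rewrite !ffunE; case: eqP].
Qed.

Lemma elim_closed_del Q : elim_closed Q -> elim_closed (svdel @: Q).
Proof.
move=> Qelim _ _ /imsetP[X XQ ->] /imsetP[Y YQ ->] f /svsepP[b].
rewrite !ffunE; case: (eqVneq f e) => // fe Xf Yf.
have [|Z [ZQ Zf ZE]] := Qelim X Y XQ YQ f; first by apply/svsepP; exists b.
exists (svdel Z); split; [exact: imset_f|by rewrite ffunE (negPf fe)|].
move=> g; rewrite !ffunE; case: (eqVneq g e) => // ge gXY.
rewrite ZE ?ffunE//; apply: contraNN gXY => /svsepP[c Xg Yg].
by apply/svsepP; exists c; rewrite ffunE (negPf ge).
Qed.
End Deletion.

(** * Contractibility of sets closed under composition and elimination *)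

Section Contractibility.
Variable R : realType.

Local Notation "'Delta' P" := (@realization R _ (order_complex (@svle E) P))
  (at level 10, P at level 9).

(* The elements of the fiber lying on the other side of e than X0 are pushed
   onto the hyperplane e, and then the fiber is pulled towards X0. *)
Lemma contractible_del_fiber e Q Z : comp_closed Q -> elim_closed Q ->
  Z \in svdel e @: Q -> contractible R (Delta [set X in Q | svle Z (svdel e X)]).
Proof.
move=> Qcomp Qelim ZQ'; set S := [set X in Q | _].
(* If [Z] itself is in [Q], it is the least element of the fiber. *)
have [ZQ|ZQ] := boolP (Z \in Q).
  have Ze : Z e = None by case/imsetP: ZQ' => X _ ->; rewrite ffunE eqxx.
  apply: (@contractible_cone R _ _ S Z svle_refl svle_anti svle_trans).
    by rewrite inE ZQ svdel_id// svle_refl.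
  move=> X; rewrite inE => /andP[_ ZX]; exact: svle_trans ZX (svdel_le e X).
have [X0 X0Q ZE] := imsetP ZQ'.
have [s X0e] : exists s, X0 e = Some s.
  by case X0e: (X0 e) => [s|]; [exists s|move: ZQ; rewrite ZE svdel_id// X0Q].
pose a X := if X e == Some (~~ s) then svdel e X else X.
pose b X := svcomp X0 (a X).
have Z_some X f c : X \in S -> f != e -> X0 f = Some c -> X f = Some c.
  rewrite inE => /andP[_ ZX] fe X0f; apply: (svle_some (svdel_le e X)).
  by apply: (svle_some ZX); rewrite ZE ffunE (negPf fe).
have aS X : X \in S -> a X \in S.
  move=> XS; rewrite /a; case: eqP => // Xe; have := XS; rewrite !inE => /andP[XQ ZX].
  rewrite svdel_idem ZX andbT.
  (* Off [e], the vector [X] agrees with [X0] wherever [X0] is nonzero, so [e] is the only separated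
     element and elimination returns exactly [svdel e X]. *)
  have [|W [WQ We WE]] := Qelim X0 X X0Q XQ e; first by apply/svsepP; exists s.
  suff -> : svdel e X = W by [].
  apply/ffunP => f; rewrite ffunE; case: eqVneq => [->//|fe].
  rewrite WE ?ffunE; first by case X0f: (X0 f) => [c|] //; exact: Z_some X0f.
  by apply/svsepP => -[c X0f]; rewrite (Z_some _ _ _ XS fe X0f) => -[]; case: (c).
have a_mono : {in S &, {homo a : X Y / svle X Y}}.
  move=> X Y _ _ XY; rewrite /a.
  case: (eqVneq (X e) (Some (~~ s))) => Xe.
    by rewrite (svle_some XY Xe) eqxx; exact: svdel_mono.
  case: (eqVneq (Y e) (Some (~~ s))) => // Ye; rewrite -(svdel_id (X := X) (e := e)).
    exact: svdel_mono.
  by move: Xe; have /svleP/(_ e) := XY; rewrite Ye; case: (X e) => // c /eqP ->; rewrite eqxx.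
have a_b X : X \in S -> svle (a X) (b X).
  move=> XS; apply/svleP => f; rewrite ffunE.
  case X0f: (X0 f) => [c|]; last exact: sign_le_refl.
  case: (eqVneq f e) X0f => [->|fe]; last first.
    by move=> X0f; rewrite (Z_some _ _ _ (aS _ XS) fe X0f) sign_le_refl.
  rewrite X0e => -[<-]; rewrite /a; case: eqP; first by rewrite ffunE eqxx.
  by case: (X e) => [[]|] //; case: (s).
apply: (@contractible_zigzag R _ _ S a b X0 svle_refl svle_anti svle_trans) => //.
- by rewrite inE X0Q ZE svle_refl.
- move=> X XS; have := aS X XS; rewrite !inE => /andP[aXQ _].
  by rewrite Qcomp//= ZE; apply: svdel_mono; exact: svle_compl.
- by move=> X Y XS YS XY; apply: svcomp_mono; exact: a_mono.
- move=> X _; rewrite /a; case: ifP => _; [exact: svdel_le|exact: svle_refl].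
- by move=> X _; exact: svle_compl.
Qed.

Theorem contractible_elim_closed Q :
  Q != finset.set0 -> comp_closed Q -> elim_closed Q -> contractible R (Delta Q).
Proof.
(* The induction runs over a list [s] outside which all vectors vanish; with [s] empty only [sv0] is
   left. *)
suff ext (s : seq E) Q' : (forall X f, X \in Q' -> f \notin s -> X f = None) ->
    Q' != finset.set0 -> comp_closed Q' -> elim_closed Q' -> contractible R (Delta Q').
  by apply: (ext (enum E)) => X f _; rewrite mem_enum.
elim: s Q' => [|e s IHs] {}Q Qs Q0 Qcomp Qelim.
  have [X XQ] := finset.set0Pn _ Q0.
  apply: (@contractible_cone R _ _ Q X svle_refl svle_anti svle_trans) => // Y _.
  by apply/svleP => f; rewrite Qs.
apply: (@contractible_fibers R _ _ _ (@svle E) _ (svdel e @: Q) (svdel e)); last first.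
  apply: IHs.
  - move=> _ f /imsetP[X XQ ->] fs; rewrite ffunE; case: (eqVneq f e) => // fe.
    by apply: Qs => //; rewrite inE negb_or fe.
  - by rewrite imset_eq0.
  - exact: comp_closed_del.
  - exact: elim_closed_del.
apply: (@fiber_homotopy_equivalence R _ _ _ _ svle_refl svle_anti svle_trans
  svle_refl svle_anti svle_trans _ _ _ (fun Z => [set X in Q | svle Z (svdel e X)])
  (fun Z => [set Z' in svdel e @: Q | svle Z Z'])).
- by move=> X XQ; exact: imset_f.
- by move=> X Y _ _; exact: svdel_mono.
- by move=> Z _; apply/fintype.subsetP => X; rewrite inE => /andP[].
- by move=> Z _; apply/fintype.subsetP => X; rewrite inE => /andP[].
- by move=> Z ZQ; exact: contractible_del_fiber.
- move=> Z ZQ; apply: (@contractible_cone R _ _ _ Z svle_refl svle_anti svle_trans).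
    by rewrite inE ZQ svle_refl.
  by move=> X; rewrite inE => /andP[].
- move=> Z Z' _ _ ZZ'; apply/fintype.subsetP => X; rewrite !inE => /andP[-> /=].
  exact: svle_trans.
- move=> Z Z' _ _ ZZ'; apply/fintype.subsetP => X; rewrite !inE => /andP[-> /=].
  exact: svle_trans.
- by move=> Z ZQ; rewrite inE ZQ svle_refl.
- by move=> X XQ; rewrite inE XQ svle_refl.
- by move=> Z _ X; rewrite !inE => /andP[XQ ->]; rewrite imset_f.
Qed.

End Contractibility.
End SignVectorTheory.

(** * Upper sets and chains of lexicographic types *)

Section UpperSets.
Import numFieldNormedType.Exports.
Local Open Scope set_scope.
Variables (R : realType) (E : finType).
Implicit Types (X Y Z : signvec E) (Q C K L : {set signvec E}).

Local Notation "'Delta' P" := (@realization R _ (order_complex (@svle E) P))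
  (at level 10, P at level 9).

(** Pairs bounded above have their join in [C]; this gives the elements of [C] below a fixed vector
    a greatest one. *)
Definition conformal_closed C : Prop :=
  forall X Y Z, X \in C -> Y \in C -> svle X Z -> svle Y Z -> svcomp X Y \in C.

Definition up_in K C : {set signvec E} := [set Y in K | [exists Z in C, svle Z Y]].

Lemma up_inP K C Y :
  reflect (Y \in K /\ exists2 Z, Z \in C & svle Z Y) (Y \in up_in K C).
Proof.
rewrite inE; apply: (iffP andP) => -[-> H]; split=> //.
  by have [Z /andP[ZC ZY]] := existsP H; exists Z.
by apply/existsP; have [Z ZC ZY] := H; exists Z; rewrite ZC.
Qed.

(** The default [sv0] is taken only when no greatest element exists; [greatest_belowP] excludes this
    for [Y] above some element of a conformally closed [C]. *)
Definition greatest_below C Y : signvec E :=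
  odflt sv0 [pick X in C | svle X Y && [forall Z in C, svle Z Y ==> svle Z X]].

(** Among the elements of [C] below [Y], one of largest support absorbs all others: composing it
    with [Z] cannot enlarge its support, so [Z] lies below it. *)
Lemma greatest_belowP C Y X0 :
  conformal_closed C -> X0 \in C -> svle X0 Y ->
  [/\ greatest_below C Y \in C, svle (greatest_below C Y) Y &
      forall Z, Z \in C -> svle Z Y -> svle Z (greatest_below C Y)].
Proof.
move=> Cconf X0C X0Y; rewrite /greatest_below.
case: pickP => [X /and3P[XC XY /forall_inP X_max]|no] /=.
  by split=> // Z ZC ZY; exact: implyP (X_max Z ZC) ZY.
have X0S : [pred Z in C | svle Z Y] X0 by rewrite /= X0C.
case: (arg_maxnP (fun Z => #|~: zeros Z|) X0S) => X XS X_max.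
have [XC XY] := andP XS.
have /negP[] := negbT (no X); rewrite XC XY /=; apply/forall_inP => Z ZC; apply/implyP => ZY.
have XZ : ~: zeros X = ~: zeros (svcomp X Z).
  apply/eqP; rewrite finset.eqEcard; apply/andP; split.
    apply/fintype.subsetP => f; rewrite !inE ffunE; by case: (X f).
  by apply: X_max; rewrite /= (Cconf _ _ _ XC ZC XY ZY) svcomp_ub.
apply/svleP => f; have := svle_compr XY ZY => /svleP/(_ f); have /setP/(_ f) := XZ.
by rewrite !inE !ffunE; case: (X f) => // /esym/negPn/eqP ->.
Qed.

(** Sending [Y] to the greatest element of [C] below it is monotone, and its fiber above [Z]
    consists of the elements of [K] above [Z]. That fiber prescribes the signs on the support of
    [Z], hence inherits composition and elimination and is contractible, being nonempty. *)
Lemma contractible_up_in K C :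
  comp_closed K -> elim_closed K -> conformal_closed C ->
  (forall Z, Z \in C -> exists2 Y, Y \in K & svle Z Y) ->
  contractible R (Delta C) -> contractible R (Delta (up_in K C)).
Proof.
move=> Kcomp Kelim Cconf CK C_contr.
have gP Y : Y \in up_in K C -> [/\ greatest_below C Y \in C, svle (greatest_below C Y) Y &
      forall Z, Z \in C -> svle Z Y -> svle Z (greatest_below C Y)].
  by move=> /up_inP[_ [Z ZC ZY]]; exact: greatest_belowP ZC ZY.
apply: contractible_fibers C_contr.
pose S Z := [set Y in K | svle Z Y].
have SK Z : Z \in C -> S Z \subset up_in K C.
  move=> ZC; apply/fintype.subsetP => Y; rewrite inE => /andP[YK ZY].
  by apply/up_inP; split => //; exists Z.
apply: (@fiber_homotopy_equivalence R _ _ _ _ (@svle_refl E) (@svle_anti E) (@svle_trans E)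
  (@svle_refl E) (@svle_anti E) (@svle_trans E) _ _ (greatest_below C) S
  (fun Z => [set Z' in C | svle Z Z'])).
- by move=> Y /gP[].
- move=> X Y /gP[XC XX _] /gP[_ _ Y_max] XY; apply: Y_max => //; exact: svle_trans XY.
- exact: SK.
- by move=> Z _; apply/fintype.subsetP => X; rewrite inE => /andP[].
- move=> Z ZC; have [Y0 Y0K ZY0] := CK Z ZC.
  have pN X : svle Z X <-> forall f c, Z f != None /\ c = Z f -> X f = c.
    split=> [ZX f c [+ ->]|ZX].
      by case Zf: (Z f) => [b|//] _; exact: svle_some Zf.
    apply/svleP => f; case Zf: (Z f) => [b|//].
    by rewrite (ZX f (Some b)) ?sign_le_refl// Zf.
  apply: contractible_elim_closed.
  + by apply/finset.set0Pn; exists Y0; rewrite inE Y0K.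
  + exact: comp_closed_prescribed pN Kcomp.
  + exact: elim_closed_prescribed pN Kelim.
- move=> Z ZC.
  apply: (@contractible_cone R _ _ _ Z (@svle_refl E) (@svle_anti E) (@svle_trans E)).
    by rewrite inE ZC svle_refl.
  by move=> X; rewrite inE => /andP[].
- move=> Z Z' _ _ ZZ'; apply/fintype.subsetP => X; rewrite !inE => /andP[-> /=].
  exact: svle_trans.
- move=> Z Z' _ _ ZZ'; apply/fintype.subsetP => X; rewrite !inE => /andP[-> /=].
  exact: svle_trans.
- by move=> Z ZC; rewrite inE ZC svle_refl.
- by move=> Y YU; have [_ gY _] := gP Y YU; case/up_inP: YU => YK _; rewrite inE YK.
- move=> Z ZC Y YS; have /(fintype.subsetP (SK Z ZC))/gP[gC _ g_max] := YS.
  by move: YS; rewrite !inE => /andP[_ ZY]; rewrite gC g_max.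
Qed.

Section LexicographicTypes.
Variables (r : nat) (e : 'I_r -> E).

Definition lex_type (i : 'I_r) (eps : bool) (X : signvec E) : bool :=
  (X (e i) == Some eps) && [forall j : 'I_r, (j < i) ==> (X (e j) == None)].

Lemma lex_typeP i eps X :
  reflect (X (e i) = Some eps /\ forall j : 'I_r, j < i -> X (e j) = None)
          (lex_type i eps X).
Proof.
apply: (iffP andP) => [[/eqP-> /forallP H]|[-> H]].
  by split=> // j ji; apply/eqP; exact: implyP (H j) ji.
by split=> //; apply/forallP => j; apply/implyP => /H ->.
Qed.

Lemma lex_type_prescribed i eps X :
  lex_type i eps X <-> forall f c,
    (f = e i /\ c = Some eps) \/ (exists2 j : 'I_r, j < i & f = e j /\ c = None) ->
    X f = c.
Proof.
split=> [/lex_typeP[Xi Xj] f c [[-> ->]//|[j ji [-> ->]]]|H]; first exact: Xj.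
apply/lex_typeP; split=> [|j ji]; apply: H; first by left.
by right; exists j.
Qed.

Variables (L : {set signvec E}) (w : 'I_r -> bool).
Hypotheses (L0 : sv0 \in L) (Lcomp : comp_closed L) (Lelim : elim_closed L).

(** The possible top vectors of chains with types indexed by [I]; with [[set sv0]] for the empty
    list, a one-element list gives all vectors of that type in [L]. *)
Fixpoint lex_chain (I : seq 'I_r) : {set signvec E} :=
  if I is i :: I' then up_in [set Y in L | lex_type i (w i) Y] (lex_chain I')
  else [set sv0].

Lemma lex_chain_sub I : lex_chain I \subset L.
Proof.
case: I => [|i I] /=; first by rewrite finset.sub1set.
by apply/fintype.subsetP => Y /up_inP[]; rewrite inE => /andP[].
Qed.

(** The vanishing clause drives the induction: a vector [Z] for the later indices is 0 at [e i] and
    before, so [svcomp Z Y0] has the type of [Y0] and lies above [Z]. This supplies the nonempty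
    fibers that [contractible_up_in] asks for. *)
Lemma lex_chain_spec I : pairwise (fun i j : 'I_r => i < j) I ->
  {in I, forall i, exists2 Y, Y \in L & lex_type i (w i) Y} ->
  [/\ contractible R (Delta (lex_chain I)), conformal_closed (lex_chain I) &
      forall Z (j : 'I_r), Z \in lex_chain I -> (forall i, i \in I -> j < i) -> Z (e j) = None].
Proof.
elim: I => [_ _|i I IHI] /=.
  split.
  - by apply: (@contractible_cone R _ _ _ sv0 (@svle_refl E) (@svle_anti E) (@svle_trans E)) => [|X _];
      [rewrite inE|exact: svle0].
  - by move=> X Y Z; rewrite !inE => /eqP -> /eqP -> _ _; apply/eqP/ffunP => f; rewrite !ffunE.
  - by move=> Z j; rewrite inE => /eqP -> _; rewrite ffunE.
move=> /andP[/allP iI I_sorted] I_ex.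
have [j jI|contr conf zer] := IHI I_sorted; first by apply: I_ex; rewrite inE jI orbT.
set K := [set Y in L | _].
have Kcomp : comp_closed K by exact: comp_closed_prescribed (lex_type_prescribed i (w i)) Lcomp.
have Kelim : elim_closed K by exact: elim_closed_prescribed (lex_type_prescribed i (w i)) Lelim.
split.
- apply: contractible_up_in => // Z ZC.
  have [Y0 Y0L /lex_typeP[Y0i Y0j]] := I_ex i (mem_head _ _).
  exists (svcomp Z Y0); last exact: svle_compl.
  have ZL := fintype.subsetP (lex_chain_sub I) Z ZC; rewrite inE Lcomp//=.
  apply/lex_typeP; rewrite ffunE (zer Z i ZC); last by move=> j /iI.
  split=> // j ji; rewrite ffunE (zer Z j ZC) ?Y0j// => k /iI; exact: ltn_trans.
- move=> X Y Z /up_inP[XK [X' X'C X'X]] /up_inP[YK _] XZ YZ; apply/up_inP.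
  split; first exact: Kcomp.
  by exists X' => //; apply: svle_trans X'X _; exact: svle_compl.
- move=> Z j /up_inP[]; rewrite inE => /andP[_ /lex_typeP[_ Zj]] _ ji.
  by apply: Zj; apply: ji; exact: mem_head.
Qed.

(** Witnesses for separate indices need not be comparable, but they can be stacked: the vector [Z]
    found for the later indices vanishes up to [e i], so composing it with the witness for [i] gives
    type [i] and stays below [Y]. *)
Lemma up_lex_chainP I Y : pairwise (fun i j : 'I_r => i < j) I ->
  (exists2 Z, Z \in lex_chain I & svle Z Y) <->
  (forall i, i \in I -> exists X, [/\ X \in L, svle X Y & lex_type i (w i) X]).
Proof.
elim: I => [_|i I IHI] /=.
  by split=> [_ i|_]; [rewrite in_nil|exists sv0; [rewrite inE|exact: svle0]].
move=> /andP[/allP iI I_sorted]; have {IHI} [IH1 IH2] := IHI I_sorted; split.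
  move=> [Z /up_inP[]]; rewrite inE => /andP[ZL Zi] [Z' Z'C Z'Z] ZY j.
  rewrite inE => /orP[/eqP ->|jI]; first by exists Z.
  by apply: IH1 => //; exists Z' => //; exact: svle_trans ZY.
move=> H; have [j jI|Z ZC ZY] := IH2; first by apply: H; rewrite inE jI orbT.
have [X [XL XY /lex_typeP[Xi Xj]]] := H i (mem_head _ _).
have Z_none (j : 'I_r) : j <= i -> Z (e j) = None.
  case: I iI I_sorted {IH1 IH2 H} ZC => [|k I] iI _ /=.
    by rewrite inE => /eqP -> _; rewrite ffunE.
  move=> /up_inP[]; rewrite inE => /andP[_ /lex_typeP[_ Zk]] _ ji.
  by apply: Zk; apply: leq_ltn_trans ji _; apply: iI; exact: mem_head.
exists (svcomp Z X); last exact: svcomp_ub.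
apply/up_inP; split; last by exists Z => //; exact: svle_compl.
have ZL := fintype.subsetP (lex_chain_sub I) Z ZC; rewrite inE Lcomp//=.
apply/lex_typeP; rewrite ffunE Z_none//; split => // j ji.
by rewrite ffunE Z_none ?Xj// ltnW.
Qed.

End LexicographicTypes.
End UpperSets.

(** * Covectors and flags *)

Section Covectors.
Local Open Scope set_scope.
Variables (E : finType) (M : orientedMatroid E).
Implicit Types (X Y Z W : signvec E) (G H : {set E}).

Lemma svneq0_ex X : X != sv0 -> exists f, X f != None.
Proof.
move=> X0; apply/existsP; apply: contraNT X0 => /existsPn X0.
by apply/eqP/ffunP => f; rewrite ffunE; apply/eqP/negPn/X0.
Qed.

Lemma svneq0_at X f : X f != None -> X != sv0.
Proof. by apply: contraNneq => ->; rewrite ffunE. Qed.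

Lemma zeros_svle X Y : svle X Y -> zeros Y \subset zeros X.
Proof.
by move=> XY; apply/fintype.subsetP => f; rewrite !inE => /eqP Yf; rewrite (svle_none XY Yf).
Qed.

Lemma svle_zeros_eq X Y : svle X Y -> zeros X \subset zeros Y -> X = Y.
Proof.
move=> XY zXY; apply/ffunP => f; case Xf: (X f) => [b|]; first by rewrite (svle_some XY Xf).
by have /fintype.subsetP/(_ f) := zXY; rewrite !inE Xf => /(_ isT)/eqP ->.
Qed.

Lemma svoppK : involutive (@svopp E).
Proof. by move=> X; apply/ffunP => f; rewrite !ffunE; case: (X f) => [[]|]. Qed.

Lemma svopp_le X Y : svle (svopp X) (svopp Y) = svle X Y.
Proof.
by apply: eq_forallb => f; rewrite !ffunE; case: (X f) (Y f) => [[]|] [[]|].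
Qed.

Lemma zerosN X : zeros (svopp X) = zeros X.
Proof. by apply/setP => f; rewrite !inE ffunE; case: (X f). Qed.

Lemma svopp_neq0 X : (svopp X != sv0) = (X != sv0).
Proof.
apply/idP/idP => /svneq0_ex[f Xf]; apply: (@svneq0_at _ f); move: Xf; rewrite ffunE; by case: (X f).
Qed.

Lemma svsep_none X Z g : Z g = None -> g \notin svsep X Z.
Proof. by move=> Zg; apply/svsepP => -[b _]; rewrite Zg. Qed.

(* Eliminating repeatedly against X makes Z conform to X. *)
Lemma conformal_elimination X Z f :
  X \in covectors M -> Z \in covectors M -> zeros X \subset zeros Z ->
  f \in svsep X Z ->
  exists W, [/\ W \in covectors M, svle W X, W != X &
                forall g, g \notin svsep X Z -> W g = X g].
Proof.
move=> XM; have [n] := ubnP #|svsep X Z|; elim: n Z f => // n IHn Z f nZ ZM zXZ fXZ.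
have [W [WM Wf WE]] := covectors_elim XM ZM fXZ.
have {}WE g : g \notin svsep X Z -> W g = X g.
  move=> /WE ->; rewrite ffunE; case Xg: (X g) => [//|].
  by have /fintype.subsetP/(_ g) := zXZ; rewrite !inE Xg => /(_ isT)/eqP.
have WX : W != X.
  apply/eqP => WX; move: fXZ => /svsepP[b]; rewrite -WX Wf; by [].
(* [W] agrees with [X] outside the old separation set and vanishes at [f], so replacing [Z] by [W]
   shrinks this set strictly. *)
have sWZ : svsep X W \subset svsep X Z.
  apply/fintype.subsetP => g; apply: contraLR => /WE Wg.
  by apply/svsepP => -[b Xg]; rewrite Wg Xg => -[]; case: (b).
have [sW0|] := set_0Vmem (svsep X W).
  exists W; split => //; apply/svleP => g.
  have [gXZ|/WE ->] := boolP (g \in svsep X Z); last exact: sign_le_refl.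
  have /setP/(_ g) := sW0; rewrite finset.in_set0 => /negbT/svsepP gXW.
  case Wg: (W g) => [c|//]; have [b Xg _] := svsepP _ _ _ gXZ; rewrite Xg.
  case: (eqVneq c b) => [->|cb]; first exact: sign_le_refl.
  by case: gXW; exists b => //; rewrite Wg; congr Some; move: cb; case: (c) (b) => [] [].
move=> [f' f'XW]; have [||||V [VM VX VnX VE]] := IHn W f' => //.
- rewrite ltnS in nZ; apply: leq_trans nZ; apply: proper_card; apply/fintype.properP; split=> //.
  by exists f => //; exact: svsep_none.
- apply/fintype.subsetP => g; rewrite !inE => Xg; rewrite WE//.
  by apply/svsepP => -[b]; rewrite (eqP Xg).
exists V; split=> // g gXZ; apply: VE; apply: contraNN gXZ; exact: (fintype.subsetP sWZ).
Qed.

Lemma nonzero_covectorsE X : (X \in nonzero_covectors M) = (X != sv0) && (X \in covectors M).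
Proof. by rewrite !inE. Qed.

Lemma cocircuitP X :
  reflect [/\ X \in covectors M, X != sv0 &
              forall Y, Y \in covectors M -> Y != sv0 -> svle Y X -> Y = X]
          (X \in cocircuits M).
Proof.
rewrite inE nonzero_covectorsE; apply: (iffP andP).
  move=> [/andP[X0 XM] /forall_inP X_min]; split=> // Y YM Y0 YX.
  by apply/eqP; apply: implyP YX; apply: X_min; rewrite nonzero_covectorsE Y0.
move=> [XM X0 X_min]; rewrite X0 XM; split=> //; apply/forall_inP => Y.
by rewrite nonzero_covectorsE => /andP[Y0 YM]; apply/implyP => YX; apply/eqP/X_min.
Qed.

Lemma cocircuit_no_smaller X W g :
  X \in cocircuits M -> W \in covectors M -> svle W X -> W g != None -> W = X.
Proof. by move=> /cocircuitP[_ _ X_min] WM WX /svneq0_at W0; exact: X_min. Qed.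

(** A covector of least support among those below [Y] and nonzero at [g] is a cocircuit: if a
    smaller nonzero covector [Z] vanished at [g], elimination against [svopp Z] would shrink it
    further without changing its value at [g]. *)
Lemma cocircuit_below Y g : Y \in covectors M -> Y g != None ->
  exists X, [/\ X \in cocircuits M, svle X Y & X g = Y g].
Proof.
move=> YM Yg; have YS : [pred X in covectors M | svle X Y && (X g != None)] Y.
  by rewrite /= YM svle_refl.
case: (arg_minnP (fun X => #|~: zeros X|) YS) => X /and3P[XM XY Xg] X_min.
have small W : W \in covectors M -> svle W X -> W g != None -> W = X.
  move=> WM WX Wg; apply: svle_zeros_eq => //.
  have WXC : ~: zeros W \subset ~: zeros X by rewrite finset.setCS zeros_svle.
  have /X_min XW : [pred X in covectors M | svle X Y && (X g != None)] W.
    by rewrite /= WM (svle_trans WX XY).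
  have /eqP WXE : ~: zeros W == ~: zeros X by rewrite finset.eqEcard WXC.
  by rewrite -finset.setCS WXE.
exists X; split=> //; last first.
  by case Xg': (X g) Xg => [b|//] _; rewrite (svle_some XY Xg').
apply/cocircuitP; split => //; first exact: svneq0_at Xg.
move=> Z ZM Z0 ZX; have [Zg|Zg] := eqVneq (Z g) None; last exact: small.
have [f] := svneq0_ex Z0; case Zf: (Z f) => [b|//] _.
have [|||W [WM WX WnX WE]] := @conformal_elimination X (svopp Z) f XM.
- exact: covectorsN.
- by rewrite zerosN; exact: zeros_svle.
- by apply/svsepP; exists b; rewrite ?ffunE ?Zf// (svle_some ZX Zf).
by move: WnX; rewrite (small W)// ?eqxx// WE//; apply: svsep_none; rewrite ffunE Zg.
Qed.

Lemma flat_topE : flat_top M = [set: E].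
Proof.
apply/eqP; rewrite finset.eqEsubset finset.subsetT; apply: (finset.bigcup_max [set: E]) => //.
apply/imsetP; exists sv0; first exact: covectors0.
by apply/setP => f; rewrite !inE ffunE.
Qed.

Lemma zeros_flat X : X \in covectors M -> zeros X \in flats M.
Proof. exact: imset_f. Qed.

Lemma zeros_eqT X : (zeros X == flat_top M) = (X == sv0).
Proof.
rewrite flat_topE; apply/eqP/eqP => [/setP zX|->]; last by apply/setP => f; rewrite !inE ffunE.
by apply/ffunP => f; have := zX f; rewrite !inE ffunE => /eqP.
Qed.

(** Cocircuits are minimal in the sign order and coatoms maximal for inclusion, and a covector [Y]
    with a larger zero set than [X] need not lie below [X]. With the sign of [Y] chosen against [X]
    at some [f], elimination produces a nonzero covector strictly below [X], contradicting
    minimality. *)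
Lemma coatomP H :
  reflect (exists2 X, X \in cocircuits M & zeros X = H) (H \in coatoms M).
Proof.
rewrite inE; apply: (iffP maxsetP) => [[/= /andP[/imsetP[X XM ->]]]|].
  rewrite zeros_eqT => X0 H_max; exists X => //; apply/cocircuitP; split=> // Y YM Y0 YX.
  apply: svle_zeros_eq => //; suff -> : zeros Y = zeros X by [].
  by apply: H_max; rewrite ?zeros_svle//= zeros_flat// zeros_eqT.
move=> [X XC <-]; have /cocircuitP[XM X0 _] := XC.
split=> [/=|_ /= /andP[/imsetP[Y YM ->]]]; first by rewrite zeros_flat// zeros_eqT.
rewrite zeros_eqT => Y0 zXY; apply/eqP; rewrite finset.eqEsubset zXY andbT.
apply/fintype.subsetP => g; rewrite !inE => Yg; apply: contraT => Xg.
have [f Yf] := svneq0_ex Y0.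
have Xf : X f != None.
  by apply: contraNN Yf => Xf; have /fintype.subsetP/(_ f) := zXY; rewrite !inE; exact.
have [Z [ZM zZ fXZ]] : exists Z, [/\ Z \in covectors M, zeros Z = zeros Y & f \in svsep X Z].
  case Xf': (X f) Xf => [b|//] _; case Yf': (Y f) Yf => [c|//] _.
  have [cb|cb] := eqVneq c b.
    exists (svopp Y); rewrite zerosN covectorsN//; split=> //; apply/svsepP; exists b => //.
    by rewrite ffunE Yf' cb.
  exists Y; split=> //; apply/svsepP; exists b => //; rewrite Yf'; congr Some.
  by move: cb; case: (c) (b) => [] [].
have [|W [WM WX WnX WE]] := conformal_elimination XM ZM _ fXZ; first by rewrite zZ.
have Wg : W g = X g.
  by apply: WE; apply: svsep_none; apply/eqP; have /setP/(_ g) := zZ; rewrite !inE Yg.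
by move: WnX; rewrite (cocircuit_no_smaller (g := g) XC WM WX) ?eqxx// Wg.
Qed.

(** Different cocircuits with one zero set would be opposite at some [f], and elimination would
    leave a smaller covector with the value at [g] kept. *)
Lemma cocircuit_inj X Y g : X \in cocircuits M -> Y \in cocircuits M ->
  zeros X = zeros Y -> X g = Y g -> X g != None -> X = Y.
Proof.
move=> XC YC zXY XYg Xg; apply/eqP; apply: contraT => XY.
have [/cocircuitP[XM _ _] /cocircuitP[YM _ _]] := (XC, YC).
have [f fXY] : exists f, X f != Y f.
  apply/existsP; apply: contraNT XY => /existsPn XY; apply/eqP/ffunP => f.
  by apply/eqP/negPn/XY.
have [||W [WM WX WnX WE]] := @conformal_elimination X Y f XM YM; first by rewrite zXY.
  have zf : (X f == None) = (Y f == None) by have /setP/(_ f) := zXY; rewrite !inE.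
  apply/svsepP; case: (X f) (Y f) fXY zf => [b|] [c|] //= bc _; exists b => //; congr Some.
  by move: bc; case: (b) (c) => [] [].
have Wg : W g = X g.
  by apply: WE; apply/svsepP => -[b Xb]; rewrite -XYg Xb => -[]; case: (b).
by move: WnX; rewrite (cocircuit_no_smaller (g := g) XC WM WX) ?eqxx// Wg.
Qed.

Lemma cocircuitN X : X \in cocircuits M -> svopp X \in cocircuits M.
Proof.
move=> /cocircuitP[XM X0 X_min]; apply/cocircuitP; split.
- exact: covectorsN.
- by rewrite svopp_neq0.
- move=> Y YM Y0 YX; rewrite -[Y]svoppK; congr svopp; apply: X_min.
  + exact: covectorsN.
  + by rewrite svopp_neq0.
  + by rewrite -svopp_le svoppK.
Qed.

End Covectors.

(** * Flags, types of covectors and the map iota *)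

Section FlagTypes.
Local Open Scope set_scope.
Variables (E : finType) (M : orientedMatroid E) (r : nat).
Variables (F : 'I_r.+1 -> {set E}) (flagF : complete_flag M F).
Variables (e : 'I_r -> E) (eF : forall i, e i \in flag_succ F i :\: flag_pred F i).
Implicit Types (X Y Z W : signvec E) (G H : {set E}).

Lemma flag_homo (i j : 'I_r.+1) : i <= j -> F i \subset F j.
Proof.
case: flagF => _ _ F_lt _; rewrite leq_eqVlt => /orP[/eqP ij|ij].
  by have /val_inj -> : val i = val j by [].
exact: proper_sub (F_lt _ _ ij).
Qed.

(** The elements [e j] with [j < k] span [F k]. In the induction, the intersection of [zeros X] with
    [F k] is a flat between two consecutive members of the flag, hence a member by maximality; it
    contains [e i], which the smaller of the two does not. *)
Lemma flag_sub_zeros X (k : 'I_r.+1) : X \in covectors M ->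
  (forall j : 'I_r, j < k -> X (e j) = None) -> F k \subset zeros X.
Proof.
case: flagF => F_flat [F0 F1] F_lt F_max XM.
move: {2}(k : nat) (erefl (k : nat)) => n; elim: n k => [|n IHn] k kn Xe.
  have -> : k = ord0 by exact: val_inj.
  by rewrite F0; apply: finset.bigcap_inf; exact: zeros_flat.
have nr : n < r by rewrite -ltnS -kn.
pose i := Ordinal nr.
have kE : F k = flag_succ F i by congr F; apply: val_inj; rewrite /= kn.
have Xi : F (widen_ord (leqnSn r) i) \subset zeros X.
  by apply: IHn => // j ji; apply: Xe; rewrite kn ltnW.
have [Y YM YE] := imsetP (F_flat k).
(* Composing covectors shows that the intersection of two flats is a flat. *)
have KE : zeros (svcomp X Y) = zeros X :&: F k.
  by apply/setP => f; rewrite YE !inE ffunE; case: (X f).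
have [||j Kj] := F_max (zeros X :&: F k).
- by rewrite -KE; apply: zeros_flat; exact: covectors_comp.
- move=> j; case: (leqP k j) => [kj|jk].
    by apply/orP; left; apply: fintype.subset_trans (finset.subsetIr _ _) (flag_homo kj).
  apply/orP; right; rewrite finset.subsetI (flag_homo (ltnW jk)) andbT.
  by apply: fintype.subset_trans Xi; apply: flag_homo; rewrite /= -ltnS -kn.
have [kj|jk] := leqP k j.
  by apply: fintype.subset_trans (flag_homo kj) _; rewrite -Kj finset.subsetIl.
have /setDP[ei /negP[]] := eF i.
have : e i \in zeros X :&: F k.
  by rewrite finset.in_setI kE ei andbT inE Xe// kn.
rewrite Kj; apply: (fintype.subsetP (flag_homo _)); by rewrite /= -ltnS -kn.
Qed.

Lemma lex_type_exists X : X \in covectors M -> X != sv0 ->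
  exists i eps, lex_type e i eps X.
Proof.
case: flagF => _ [_ F1] _ _ XM X0.
have [i0 Xi0] : exists i, [pred i | X (e i) != None] i.
  apply/existsP; apply: contraNT X0 => /existsPn Xe; rewrite -(zeros_eqT M) -F1.
  rewrite finset.eqEsubset flag_sub_zeros// => [|j _]; last by apply/eqP/negPn/Xe.
  by rewrite F1 flat_topE finset.subsetT.
case: (arg_minnP (fun i : 'I_r => val i) Xi0) => i /= Xi i_min.
case Xe: (X (e i)) Xi => [eps|//] _; exists i, eps; apply/lex_typeP; split => // j ji.
by apply/eqP; apply: contraLR ji => /i_min; rewrite -leqNgt.
Qed.

Lemma lex_type_inj X i j eps eps' :
  lex_type e i eps X -> lex_type e j eps' X -> i = j /\ eps = eps'.
Proof.
move=> /lex_typeP[Xi Xi'] /lex_typeP[Xj Xj'].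
have ij : i = j.
  apply: val_inj; case: (ltngtP i j) => // ij; first by rewrite Xj' in Xi.
  by rewrite Xi' in Xj.
by split=> //; move: Xj; rewrite -ij Xi => -[].
Qed.

Lemma first_nonzero_lex_type X i eps : lex_type e i eps X -> first_nonzero e X = Some i.
Proof.
move=> Xi; rewrite /first_nonzero; case: pickP => [j /andP[Xj Xj']|/(_ i)]; last first.
  by case/lex_typeP: Xi => -> Xj; case/negP; apply/forallP => j; apply/implyP => /Xj ->.
congr Some; case Xe: (X (e j)) Xj => [eps'|//] _.
have : lex_type e j eps' X by rewrite /lex_type Xe eqxx.
by move=> /(lex_type_inj Xi)[].
Qed.

Lemma iota_cocircuitE X i eps : lex_type e i eps X ->
  iota_cocircuit e X = [set (zeros X, eps)].
Proof.
move=> Xi; rewrite /iota_cocircuit (first_nonzero_lex_type Xi).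
by case/lex_typeP: Xi => ->.
Qed.

Lemma lex_typeN X i eps : lex_type e i (~~ eps) (svopp X) = lex_type e i eps X.
Proof.
apply/lex_typeP/lex_typeP; rewrite ffunE => -[Xi Xj]; split.
- by move: Xi; case: (X (e i)) => [b|] //= -[/negb_inj ->].
- by move=> j /Xj; rewrite ffunE; case: (X (e j)).
- by rewrite Xi.
- by move=> j /Xj; rewrite ffunE => ->.
Qed.

Lemma mem_covector_iota Y v :
  reflect (exists X i eps, [/\ X \in cocircuits M, svle X Y, lex_type e i eps X &
             v = (zeros X, eps)])
          (v \in covector_iota M e Y).
Proof.
apply: (iffP finset.bigcupP) => [[X /andP[XC XY]]|[X [i [eps [XC XY Xi ->]]]]].
  have /cocircuitP[XM X0 _] := XC; have [i [eps Xi]] := lex_type_exists XM X0.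
  by rewrite (iota_cocircuitE Xi) finset.in_set1 => /eqP ->; exists X, i, eps.
exists X; first by rewrite XC.
by rewrite (iota_cocircuitE Xi) finset.in_set1.
Qed.

Lemma lex_type_block X i eps : X \in covectors M -> lex_type e i eps X ->
  (flag_pred F i \subset zeros X) && ~~ (flag_succ F i \subset zeros X).
Proof.
move=> XM /lex_typeP[Xi Xj]; rewrite flag_sub_zeros//=.
apply/negP => /fintype.subsetP/(_ (e i)); have /setDP[-> _] := eF i.
by rewrite inE Xi => /(_ isT).
Qed.

Lemma coat_blockP H i : reflect [/\ H \in coatoms M, flag_pred F i \subset H &
    ~~ (flag_succ F i \subset H)] (H \in coat_block M F i).
Proof.
rewrite finset.in_setD ![_ \in coat _ _]inE.
case: (H \in coatoms M) => /=; first by rewrite andbC; apply: (iffP andP) => [[]|[]].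
by apply: (iffP idP) => // -[].
Qed.

Lemma coat_block_inj H i j : H \in coat_block M F i -> H \in coat_block M F j -> i = j.
Proof.
wlog ij : i j / i <= j.
  by move=> wl Hi Hj; case/orP: (leq_total i j) => /wl; [exact|move=> -> //].
move=> /coat_blockP[_ _ Hi] /coat_blockP[_ Hj _]; apply: val_inj; apply/eqP.
rewrite eqn_leq ij /= leqNgt; apply: contraNN Hi => lt_ij.
by apply: fintype.subset_trans Hj; apply: flag_homo.
Qed.

Lemma cocircuit_block X i eps : X \in cocircuits M -> lex_type e i eps X ->
  zeros X \in coat_block M F i.
Proof.
move=> XC Xi; have /cocircuitP[XM _ _] := XC.
have /andP[Fi Fi'] := lex_type_block XM Xi.
by apply/coat_blockP; split=> //; apply/coatomP; exists X.
Qed.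

Lemma cocircuit_lex_inj X Y i j eps : X \in cocircuits M -> Y \in cocircuits M ->
  zeros X = zeros Y -> lex_type e i eps X -> lex_type e j eps Y -> X = Y.
Proof.
move=> XC YC zXY Xi Yj.
have ij : i = j.
  apply: (@coat_block_inj (zeros X)); first exact: cocircuit_block Xi.
  rewrite zXY; exact: cocircuit_block Yj.
have [/lex_typeP[Xe _] /lex_typeP[Ye _]] := (Xi, Yj).
by apply: (@cocircuit_inj _ M X Y (e i)) => //; rewrite Xe // ij Ye.
Qed.

Lemma lex_type_svle X Y i eps : svle X Y -> lex_type e i eps X -> Y (e i) = Some eps.
Proof. by move=> XY /lex_typeP[Xi _]; exact: svle_some Xi. Qed.

Lemma svle_iota X Y : svle X Y -> covector_iota M e X \subset covector_iota M e Y.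
Proof.
move=> XY; apply/fintype.subsetP => v /mem_covector_iota[Z [i [eps [ZC ZX Zi ->]]]].
by apply/mem_covector_iota; exists Z, i, eps; split=> //; exact: svle_trans XY.
Qed.

(** A vertex determines its cocircuit: the coatom fixes the block, the block fixes the index [i],
    and the sign at [e i] selects one of two opposite cocircuits. Since every nonzero value of [X]
    is attained by a cocircuit below [X], the order is recovered from the vertices. *)
Lemma covector_iota_le X Y : X \in covectors M -> Y \in covectors M ->
  covector_iota M e X \subset covector_iota M e Y -> svle X Y.
Proof.
move=> XM YM XY; apply/svleP => f; case Xf: (X f) => [b|//].
have [|Z [ZC ZX Zf]] := @cocircuit_below _ M X f XM; first by rewrite Xf.
have /cocircuitP[ZM Z0 _] := ZC; have [i [eps Zi]] := lex_type_exists ZM Z0.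
have : (zeros Z, eps) \in covector_iota M e Y.
  by apply: (fintype.subsetP XY); apply/mem_covector_iota; exists Z, i, eps.
move=> /mem_covector_iota[Z' [j [eps' [Z'C Z'Y Z'j [zZ eE]]]]]; rewrite -eE in Z'j.
have ZE : Z = Z' by exact: cocircuit_lex_inj Zi Z'j.
have Yf : Y f = Some b by apply: (svle_some (X := Z)); [rewrite ZE|rewrite Zf].
by rewrite Yf sign_le_refl.
Qed.

Lemma mem_S_facet G (w : {ffun 'I_r -> bool}) H (eps : bool) :
  reflect (exists i, [/\ H \in coat_block M F i, G \subset H & eps = w i])
          ((H, eps) \in S_facet M F G w).
Proof.
apply: (iffP finset.bigcupP) => [[i _ /imsetP[H' + [-> ->]]]|[i [Hi GH ->]]].
  by rewrite finset.in_setI [_ \in coat _ _]inE => /andP[/andP[_ GH] Hi]; exists i.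
exists i => //; apply: imset_f; rewrite finset.in_setI Hi andbT inE GH andbT.
by case/coat_blockP: Hi.
Qed.

Lemma S_complexP G s :
  reflect (s != finset.set0 /\ exists w, s \subset S_facet M F G w) (s \in S_complex M F G).
Proof.
rewrite inE; apply: (iffP andP) => -[s0 H]; split=> //; first exact/existsP.
exact/existsP.
Qed.

Lemma vanishingP G X :
  reflect (X \in covectors M /\ G \subset zeros X) (X \in covectors_vanishing M G).
Proof.
rewrite inE; apply: (iffP andP) => -[XM H]; split=> //.
  by apply/fintype.subsetP => f fG; rewrite inE; exact: (forall_inP H).
by apply/forall_inP => f fG; have := fintype.subsetP H f fG; rewrite inE.
Qed.

Lemma covector_iota_in G Y : Y \in covectors_vanishing M G :\ sv0 ->
  covector_iota M e Y \in S_complex M F G.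
Proof.
rewrite finset.in_setD1 => /andP[Y0 /vanishingP[YM GY]]; apply/S_complexP; split.
  have [f Yf] := svneq0_ex Y0; have [X [XC XY _]] := cocircuit_below YM Yf.
  have /cocircuitP[XM X0 _] := XC; have [i [eps Xi]] := lex_type_exists XM X0.
  apply/finset.set0Pn; exists (zeros X, eps); apply/mem_covector_iota.
  by exists X, i, eps.
(* All cocircuits of index [i] below [Y] have the sign of [Y] at [e i], hence use one side of the
   block. If [Y] vanishes there, the value [false] is arbitrary, as no such cocircuit exists. *)
exists [ffun i => Y (e i) == Some true].
apply/fintype.subsetP => _ /mem_covector_iota[X [i [eps [XC XY Xi ->]]]].
apply/mem_S_facet; exists i; split; first exact: cocircuit_block Xi.
  exact: fintype.subset_trans GY (zeros_svle XY).
by rewrite ffunE (lex_type_svle XY Xi); case: (eps).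
Qed.

Lemma mem_swap_signs (s : {set {set E} * bool}) H eps :
  ((H, eps) \in swap_signs s) = ((H, ~~ eps) \in s).
Proof.
apply/imsetP/idP => [[[H' b] Hs [-> ->]]|Hs]; first by rewrite negbK.
by exists (H, ~~ eps) => //=; rewrite negbK.
Qed.

Lemma swap_signs_iota X :
  swap_signs (covector_iota M e X) = covector_iota M e (svopp X).
Proof.
apply/setP => -[H eps]; rewrite mem_swap_signs.
apply/mem_covector_iota/mem_covector_iota => -[Y [i [b [YC YX Yi [-> bE]]]]];
  exists (svopp Y), i, (~~ b); rewrite cocircuitN// zerosN lex_typeN; split=> //.
- by rewrite svopp_le.
- by rewrite -bE negbK.
- by rewrite -svopp_le svoppK.
- by rewrite bE.
Qed.

Lemma swap_signs_S_complex G s : s \in S_complex M F G -> swap_signs s \in S_complex M F G.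
Proof.
move=> /S_complexP[/finset.set0Pn[[H eps] Hs] [w sw]]; apply/S_complexP; split.
  by apply/finset.set0Pn; exists (H, ~~ eps); rewrite mem_swap_signs negbK.
exists [ffun i => ~~ w i]; apply/fintype.subsetP => -[K b]; rewrite mem_swap_signs.
move=> /(fintype.subsetP sw)/mem_S_facet[i [Ki GK bE]]; apply/mem_S_facet.
by exists i; rewrite ffunE -bE negbK.
Qed.

End FlagTypes.

(** * Homotopy equivalence *)

Section IotaFibers.
Import numFieldNormedType.Exports.
Local Open Scope set_scope.
Variables (R : realType) (E : finType) (M : orientedMatroid E) (r : nat).
Variables (F : 'I_r.+1 -> {set E}) (flagF : complete_flag M F).
Variables (e : 'I_r -> E) (eF : forall i, e i \in flag_succ F i :\: flag_pred F i).
Variable G : {set E}.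
Implicit Types (X Y Z : signvec E) (s t : {set {set E} * bool}).

Let L := covectors_vanishing M G.

(** What the carriers remember of a simplex. For a simplex of the complex, each block occurs with at
    most one sign. *)
Definition signed_blocks s : {set 'I_r * bool} :=
  [set z | [exists H in coat_block M F z.1, (H, z.2) \in s]].

Definition iota_fiber s : {set signvec E} :=
  [set Y in L :\ sv0 | [forall z in signed_blocks s,
     [exists X in L, svle X Y && lex_type e z.1 z.2 X]]].

(** In general larger than the upper set of [s]: a simplex may meet the same signed blocks in other
    coatoms. It has to be, since the image of a member of [iota_fiber s] need not contain [s]. *)
Definition same_blocks s : {set {set {set E} * bool}} :=
  [set t in S_complex M F G | signed_blocks s \subset signed_blocks t].

Lemma mem_same_blocks s t : (t \in same_blocks s) =
  (t \in S_complex M F G) && (signed_blocks s \subset signed_blocks t).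
Proof. exact: finset.in_set. Qed.

Lemma signed_blocksP s i eps :
  reflect (exists2 H, H \in coat_block M F i & (H, eps) \in s) ((i, eps) \in signed_blocks s).
Proof. by rewrite inE; apply: (iffP exists_inP). Qed.

Lemma signed_blocks_mono s t : s \subset t -> signed_blocks s \subset signed_blocks t.
Proof.
move=> /fintype.subsetP st; apply/fintype.subsetP => -[i eps] /signed_blocksP[H Hi /st Ht].
by apply/signed_blocksP; exists H.
Qed.

Lemma iota_fiberP s Y :
  reflect (Y \in L :\ sv0 /\ forall i eps, (i, eps) \in signed_blocks s ->
             exists X, [/\ X \in L, svle X Y & lex_type e i eps X])
          (Y \in iota_fiber s).
Proof.
rewrite [_ \in iota_fiber _]finset.in_set; apply: (iffP andP) => -[YL H]; split=> //.
  by move=> i eps /(forall_inP H)/exists_inP[X XL /andP[XY Xi]]; exists X.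
apply/forall_inP => -[i eps] /H[X [XL XY Xi]]; apply/exists_inP; exists X => //.
by rewrite XY.
Qed.

Lemma vanishing_prescribed X :
  [forall f in G, X f == None] <-> forall f c, f \in G /\ c = None -> X f = c.
Proof.
split=> [/forall_inP XG f c [fG ->]|XG]; first exact/eqP/XG.
by apply/forall_inP => f fG; apply/eqP; exact: XG.
Qed.

Lemma vanishing0 : sv0 \in L.
Proof.
apply/vanishingP; split; first exact: covectors0.
by apply/fintype.subsetP => f _; rewrite inE ffunE.
Qed.

Lemma vanishing_comp : comp_closed L.
Proof. exact: comp_closed_prescribed vanishing_prescribed (@covectors_comp _ M). Qed.

Lemma vanishing_elim : elim_closed L.
Proof. exact: elim_closed_prescribed vanishing_prescribed (@covectors_elim _ M). Qed.

Lemma vanishing_below X Y : X \in covectors M -> svle X Y -> Y \in L -> X \in L.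
Proof.
move=> XM XY /vanishingP[YM GY]; apply/vanishingP; split=> //.
exact: fintype.subset_trans GY (zeros_svle XY).
Qed.

(** A coatom of the block comes from a cocircuit [X] whose type must have index [i]; one of [X] and
    [svopp X] has the sign [eps]. *)
Lemma S_complex_lex_type s i eps : s \in S_complex M F G -> (i, eps) \in signed_blocks s ->
  exists2 Y, Y \in L & lex_type e i eps Y.
Proof.
move=> /S_complexP[_ [w sw]] /signed_blocksP[H Hi Hs].
have /mem_S_facet[j [_ GH _]] := fintype.subsetP sw _ Hs.
have /coat_blockP[/coatomP[X XC XH] _ _] := Hi; have /cocircuitP[XM X0 _] := XC.
have [k [b Xk]] := lex_type_exists flagF eF XM X0.
have ki : k = i.
  by apply: (coat_block_inj flagF (H := H)) => //; rewrite -XH; exact: (cocircuit_block flagF eF XC Xk).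
have XL : X \in L by apply/vanishingP; rewrite XH.
have [<-|bE] := eqVneq b eps; first by exists X; rewrite // -ki.
exists (svopp X); first by apply/vanishingP; rewrite zerosN XH covectorsN.
have -> : eps = ~~ b by move: bE; case: (b) (eps) => [] [].
by rewrite lex_typeN -ki.
Qed.

(** A facet containing [s] supplies the signs [w], and the increasing list [I] of blocks met by [s]
    identifies the fiber with the upper set of a [lex_chain]. *)
Lemma contractible_iota_fiber s : s \in S_complex M F G ->
  contractible R (@realization R _ (order_complex (@svle E) (iota_fiber s))).
Proof.
move=> sS; have /S_complexP[/finset.set0Pn[[H0 eps0] Hs0] [w sw]] := sS.
pose I := [seq i <- enum 'I_r | (i, w i) \in signed_blocks s].
have I_sorted : pairwise (fun i j : 'I_r => i < j) I.
  apply: pairwise_filter; have := iota_ltn_sorted 0 r.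
  by rewrite (sorted_pairwise ltn_trans) -val_enum_ord pairwise_map.
have I_ex : {in I, forall i, exists2 Y, Y \in L & lex_type e i (w i) Y}.
  by move=> i; rewrite mem_filter => /andP[/(S_complex_lex_type sS)].
have sIE i eps : (i, eps) \in signed_blocks s -> eps = w i.
  move=> /signed_blocksP[H Hi /(fintype.subsetP sw)/mem_S_facet[j [Hj _ ->]]].
  by rewrite (coat_block_inj flagF Hi Hj).
have [C_contr C_conf _] := lex_chain_spec R vanishing0 vanishing_comp vanishing_elim I_sorted I_ex.
suff -> : iota_fiber s = up_in L (lex_chain e L w I).
  apply: contractible_up_in => //; [exact: vanishing_comp|exact: vanishing_elim|].
  move=> Z ZC; exists Z; last exact: svle_refl.
  exact: (fintype.subsetP (lex_chain_sub e w vanishing0 I)).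
have up_lex Y := up_lex_chainP e w vanishing0 vanishing_comp Y I_sorted.
apply/setP => Y; apply/iota_fiberP/up_inP => [[]|[YL /up_lex YC]].
  rewrite finset.in_setD1 => /andP[_ YL] H; split=> //; apply/up_lex => i.
  by rewrite mem_filter => /andP[/H].
split; last first.
  move=> i eps iS; have eE := sIE _ _ iS; rewrite eE in iS *.
  by apply: YC; rewrite mem_filter iS mem_enum.
rewrite finset.in_setD1 YL andbT.
(* Since [s] is nonempty, so is [I], and the witness for one of its indices shows that [Y] is
   nonzero. *)
have /mem_S_facet[i0 [H0i _ w0]] := fintype.subsetP sw _ Hs0.
have [|X [_ XY /lex_typeP[Xi _]]] := YC i0.
  by rewrite mem_filter mem_enum andbT; apply/signed_blocksP; exists H0; rewrite -?w0.
by apply: (@svneq0_at _ _ (e i0)); rewrite (svle_some XY Xi).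
Qed.

Lemma subset_rel_refl (T : finType) : reflexive (@subset_rel T).
Proof. by move=> s; exact: fintype.subxx. Qed.

Lemma subset_rel_anti (T : finType) : antisymmetric (@subset_rel T).
Proof. by move=> s t st; apply/eqP; rewrite finset.eqEsubset. Qed.

Lemma subset_rel_trans (T : finType) : transitive (@subset_rel T).
Proof. by move=> t s u; exact: fintype.subset_trans. Qed.

(** The comparisons [t <= t :|: s >= s] contract the set. The union is again a simplex because [t]
    meets every block of [s] with the same sign, so a facet containing [t] also contains [s]. *)
Lemma contractible_same_blocks s : s \in S_complex M F G ->
  contractible R (@realization R _
    (order_complex (@subset_rel ({set E} * bool)%type) (same_blocks s))).
Proof.
move=> sS; apply: (@contractible_zigzag R _ _ _ id (fun t => t :|: s) s
  (@subset_rel_refl _) (@subset_rel_anti _) (@subset_rel_trans _)) => //.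
- by rewrite mem_same_blocks sS fintype.subxx.
- move=> t; rewrite !mem_same_blocks => /andP[tS /fintype.subsetP st].
  rewrite (fintype.subset_trans _ (signed_blocks_mono (finset.subsetUl t s))) ?andbT; last first.
    exact/fintype.subsetP.
  have /S_complexP[t0 [w tw]] := tS; apply/S_complexP; split.
    have [v vt] := finset.set0Pn _ t0; apply/finset.set0Pn; exists v.
    by rewrite finset.in_setU vt.
  exists w; rewrite finset.subUset tw; apply/fintype.subsetP => -[H eps] Hs.
  have /S_complexP[_ [w' sw]] := sS.
  have /mem_S_facet[i [Hi GH _]] := fintype.subsetP sw _ Hs.
  have /st/signed_blocksP[H' H'i /(fintype.subsetP tw)/mem_S_facet[j [H'j _ ->]]] :
    (i, eps) \in signed_blocks s by apply/signed_blocksP; exists H.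
  by apply/mem_S_facet; exists i; split=> //; rewrite (coat_block_inj flagF H'i H'j).
- by move=> t u _ _; exact: finset.setSU.
- by move=> t _; exact: fintype.subxx.
- by move=> t _; exact: finset.subsetUl.
- by move=> t _; exact: finset.subsetUr.
Qed.

Lemma iota_homotopy_equivalence :
  induces_homotopy_equivalence R (@svle E) (@subset_rel ({set E} * bool)%type)
    (L :\ sv0) (S_complex M F G) (covector_iota M e).
Proof.
apply: (@fiber_homotopy_equivalence R _ _ _ _ (@svle_refl E) (@svle_anti E) (@svle_trans E)
  (@subset_rel_refl _) (@subset_rel_anti _) (@subset_rel_trans _) _ _ _
  iota_fiber same_blocks).
- move=> Y; exact: (covector_iota_in flagF eF).
- move=> X Y _ _; exact: (svle_iota flagF eF).
- by move=> s _; apply/fintype.subsetP => Y /iota_fiberP[].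
- by move=> s _; apply/fintype.subsetP => t; rewrite mem_same_blocks => /andP[].
- exact: contractible_iota_fiber.
- exact: contractible_same_blocks.
- move=> s t _ _ st; apply/fintype.subsetP => Y /iota_fiberP[YL H]; apply/iota_fiberP.
  by split=> // i eps /(fintype.subsetP (signed_blocks_mono st)); exact: H.
- move=> s t _ _ st; apply/fintype.subsetP => u; rewrite !mem_same_blocks => /andP[-> /=].
  exact: fintype.subset_trans (signed_blocks_mono st).
- by move=> s sS; rewrite mem_same_blocks sS fintype.subxx.
- move=> Y YL; apply/iota_fiberP; split=> // i eps /signed_blocksP[H Hi].
  move=> /(mem_covector_iota flagF eF)[X [j [b [XC XY Xj [HE bE]]]]].
  have /cocircuitP[XM _ _] := XC; exists X; split=> //.
    by apply: vanishing_below XM XY _; move: YL; rewrite finset.in_setD1 => /andP[].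
  rewrite bE (_ : i = j)//; apply: (coat_block_inj flagF Hi).
  by rewrite HE; exact: (cocircuit_block flagF eF XC Xj).
- move=> s sS Y /iota_fiberP[YL H]; rewrite mem_same_blocks (covector_iota_in flagF eF YL) /=.
  apply/fintype.subsetP => -[i eps] /H[X [/vanishingP[XM _] XY Xi]].
  have [Xe Xj] := lex_typeP _ _ _ _ Xi.
  (* A cocircuit below [X] and nonzero at [e i] inherits the type of [X], so a type found below [Y]
     is visible in a vertex of its image. *)
  have [|Z [ZC ZX Ze]] := @cocircuit_below _ M X (e i) XM; first by rewrite Xe.
  have Zi : lex_type e i eps Z.
    by apply/lex_typeP; split=> [|j /Xj Xj0]; [rewrite Ze|exact: svle_none ZX Xj0].
  apply/signed_blocksP; exists (zeros Z); first exact: (cocircuit_block flagF eF ZC Zi).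
  apply/(mem_covector_iota flagF eF); exists Z, i, eps; split=> //.
  exact: svle_trans XY.
Qed.

End IotaFibers.
Theorem proposition4p4 (R : realType) (E : finType) (M : orientedMatroid E)
    (r : nat) (rankM : om_rank M = r)
    (F : 'I_r.+1 -> {set E}) (flagF : complete_flag M F)
    (e : 'I_r -> E) (eF : forall i, e i \in flag_succ F i :\: flag_pred F i) :
  [/\ (* iota is well defined *)
      (forall X, X \in cocircuits M ->
         exists i eps, [/\ first_nonzero e X = Some i, X (e i) = Some eps &
           covector_iota M e X = [set (zeros X, eps)]%SET]) /\
      (forall Y, Y \in nonzero_covectors M ->
         covector_iota M e Y \in S_complex M F (flat_bot M)),
      (* iota is injective and order preserving *)
      {in nonzero_covectors M &, injective (covector_iota M e)} /\
      {in nonzero_covectors M &, forall X Y, svle X Y ->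
         covector_iota M e X \subset covector_iota M e Y},
      (* iota takes M_G \ {0} into S_G *)
      (forall G, G \in flats M ->
         forall Y, Y \in (covectors_vanishing M G :\ sv0)%SET ->
           covector_iota M e Y \in S_complex M F G),
      (* homotopy equivalences *)
      induces_homotopy_equivalence R (@svle E) (@subset_rel ({set E} * bool)%type)
        (nonzero_covectors M) (S_complex M F (flat_bot M)) (covector_iota M e) /\
      (forall G, G \in flats M ->
         induces_homotopy_equivalence R (@svle E)
           (@subset_rel ({set E} * bool)%type)
           (covectors_vanishing M G :\ sv0)%SET (S_complex M F G) (covector_iota M e)) &
      (* the Z_2 actions *)
      (forall s, s \in S_complex M F (flat_bot M) ->
         swap_signs s \in S_complex M F (flat_bot M)) /\
      (forall X, X \in nonzero_covectors M ->
         svopp X \in nonzero_covectors M /\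
         swap_signs (covector_iota M e X) = covector_iota M e (svopp X))].

Proof.
(* [flat_bot] lies in every zero set, so the statements about all nonzero covectors are the case
   [G = flat_bot]. *)
have botE : (covectors_vanishing M (flat_bot M) :\ sv0)%SET = nonzero_covectors M.
  apply/setP => Y; rewrite !finset.in_setD1; congr (_ && _).
  apply/vanishingP/idP => [[]//|YM]; split=> //.
  by apply: finset.bigcap_inf; exact: zeros_flat.
have bot_flat : flat_bot M \in flats M by case: flagF => F_flat [<- _] _ _.
split.
- split=> [X XC|Y YM]; last by apply: (covector_iota_in flagF eF); rewrite botE.
  have /cocircuitP[XM X0 X_min] := XC.
  have [i [eps Xi]] := lex_type_exists flagF eF XM X0.
  exists i, eps; split; first exact: first_nonzero_lex_type Xi.
    by case/lex_typeP: Xi.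
  rewrite /covector_iota (big_pred1 X) ?(iota_cocircuitE Xi)// => Y.
  apply/andP/eqP => [[/cocircuitP[YM Y0 _]]|->]; first exact: X_min.
  by rewrite XC svle_refl.
- split=> [X Y|X Y _ _ XY]; last exact: (svle_iota flagF eF).
  rewrite !nonzero_covectorsE => /andP[_ XM] /andP[_ YM] XY.
  by apply: svle_anti; rewrite !(covector_iota_le flagF eF) ?XY.
- move=> G _ Y; exact: (covector_iota_in flagF eF).
- split=> [|G _]; last exact: (iota_homotopy_equivalence R flagF eF G).
  rewrite -botE; exact: (iota_homotopy_equivalence R flagF eF (flat_bot M)).
- split=> [s|X XM]; first exact: swap_signs_S_complex.
  split; last exact: (swap_signs_iota flagF eF).
  move: XM; rewrite !nonzero_covectorsE svopp_neq0 => /andP[-> XM].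
  exact: covectorsN.
Qed.
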